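(* Let $\alpha\ge1$ and $n\ge2$ be integers, let $X_1,\ldots,X_n$ be independent random variables, each with density $(\Gamma(\alpha))^{-1}e^{-x}x^{\alpha-1}$, $x>0$, and let $S^2=(n-1)^{-1}\sum_{i=1}^n(X_i-\bar X)^2$, $S\ge 0$, with $\bar X=\frac1n\sum_{i=1}^n X_i$. Then for every $r>0$ the distribution of $S$ is given by each of the following three formulas. (1) $$\Pr\{\sqrt{n-1}\,S\le r\}=\frac{(r\sqrt n)^{\alpha n}}{\Gamma(\alpha n)}\sum_{k=0}^\infty(-1)^k\frac{\bar\gamma_{\alpha,n,k}}{\alpha n+k}P_{\alpha n,k}(r\sqrt n)+\int_0^{1/\sqrt{n-1}}G_{\alpha n}(r\sqrt n/t)\,w_{\alpha,n}(t)\,dt,$$ with the polynomials $$P_{\alpha n,k}(x)=\sum_{j=0}^{[k/2]}\binom{(\alpha n+k)/2}{j}\frac{x^{k-2j}}{(k-2j)!}.$$ (2) $$\Pr\{\sqrt{n-1}\,S\le r\}=\frac{(r\sqrt n)^{\alpha n}}{\Gamma(\alpha n)}\sum_{k=0}^\infty\frac{\bar M_{\alpha,n,k}}{\alpha n+k}\frac{(-r\sqrt n)^k}{k!}+W_{\alpha,n}\big(1/\sqrt{n-1}\big)\,G_{\alpha n}\big(r\sqrt{n(n-1)}\big)+\int_{r\sqrt{n(n-1)}}^\infty g_{\alpha n}(x)\,W_{\alpha,n}(r\sqrt n/x)\,dx.$$ (3) For every $\lambda>0$, formula (2) with its first term $\frac{(r\sqrt n)^{\alpha n}}{\Gamma(\alpha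 n)}\sum_{k=0}^\infty\frac{\bar M_{\alpha,n,k}}{\alpha n+k}\frac{(-r\sqrt n)^k}{k!}$ replaced by $$\sum_{k=0}^\infty\bar\Delta_{\alpha,n,k,\lambda}\binom{\alpha n+k-1}{k}G_{\alpha n+k}(\lambda r),\qquad \bar\Delta_{\alpha,n,k,\lambda}=\sum_{\ell=0}^k(-1)^\ell\binom{k}{\ell}\bar M_{\alpha,n,\ell,\lambda},$$ to which it is equal.
   Context: For $\beta>0$, $g_\beta(x)=x^{\beta-1}e^{-x}/\Gamma(\beta)$ and $G_\beta(x)=\int_0^x g_\beta(\xi)\,d\xi$ are the gamma density and distribution function of order $\beta$. $\Phi$ is the (random) angle between $(X_1,\ldots,X_n)$ and $(1,\ldots,1)$ in $\mathbb R^n$, i.e. $\sqrt n\cos\Phi=\big(\sum_iX_i\big)\big(\sum_iX_i^2\big)^{-1/2}$. Put $\varphi_n=\operatorname{arccot}(\sqrt{n-1})=\arctan(1/\sqrt{n-1})$. $W_{\alpha,n}(t)=\Pr\{\tan\Phi\le t\}$ is the distribution function of $\tan\Phi$, and $w_{\alpha,n}$ is its density; both are used only on $0\le t\le 1/\sqrt{n-1}$ (i.e. $0\le\varphi\le\varphi_n$). $\bar{\mathbb E}$ denotes truncated expectation, i.e. integration only over $\{\Phi\ge\varphi_n\}$: $\bar{\mathbb E}(f(\Phi))=\mathbb E\big(f(\Phi)\mathbf 1_{\{\Phi\ge\varphi_n\}}\big)$. The truncated moments are, for integers $k\ge0$ and $\lambda>0$, $$\bar\gamma_{\alpha,n,k}=\bar{\mathbb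 E}\big((\cos\Phi)^{\alpha n+k}\big),\quad \bar M_{\alpha,n,k}=\bar{\mathbb E}\big((\cot\Phi)^{\alpha n+k}\big)=\sum_{j=0}^\infty\binom{(\alpha n+k)/2+j-1}{j}\bar\gamma_{\alpha,n,k+2j},\quad \bar M_{\alpha,n,k,\lambda}=\bar{\mathbb E}\big((\lambda^{-1}\sqrt n\cot\Phi)^{\alpha n+k}\big).$$ $[x]$ is the integer part, and for real $x$ and integer $j\ge0$, $\binom{x}{j}=x(x-1)\cdots(x-j+1)/j!$ (equal to $1$ for $j=0$). *)

(* Defs.v *)
From HB Require Import structures.
From mathcomp Require Import all_boot all_order all_algebra.
From mathcomp Require Import all_classical all_reals all_analysis.
Import Order.TTheory GRing.Theory Num.Theory.
Import numFieldNormedType.Exports.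

Set Implicit Arguments.
Unset Strict Implicit.
Unset Printing Implicit Defensive.

Local Open Scope classical_set_scope.
Local Open Scope ring_scope.

Section Gamma.
Context {R : realType}.
Local Notation mu := (@lebesgue_measure R).

Definition Gamma (b : R) : R :=
  \int[mu]_(x in `]0, +oo[) (x `^ (b - 1) * expR (- x)).

Definition gamma_pdf (b x : R) : R :=
  if 0 < x then x `^ (b - 1) * expR (- x) / Gamma b else 0.

Definition gamma_cdf (b x : R) : R := \int[mu]_(t in `[0, x]) gamma_pdf b t.

End Gamma.

Definition cot {R : realType} (x : R) : R := cos x / sin x.

(* x (x - 1) ... (x - j + 1) / j!, for an arbitrary real x *)
Definition gbinom {R : realType} (x : R) (j : nat) : R :=
  (\prod_(i < j) (x - i%:R)) / j`!%:R.

(* P_{m,k}, with m = alpha * n *)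
Definition Ppoly {R : realType} (m k : nat) : {poly R} :=
  \sum_(j < (k./2).+1)
    (gbinom ((m + k)%:R / 2) j / (k - j.*2)`!%:R) *: 'X^(k - j.*2).

Definition is_density d (T : measurableType d) (R : realType)
    (P : probability T R) (Y : T -> R) (f : R -> R) : Prop :=
  [/\ measurable_fun setT f,
      (forall x, 0 <= f x) &
      forall A, measurable A ->
        P (Y @^-1` A) = (\int[lebesgue_measure]_(x in A) (f x)%:E)%E].

Definition mutually_independent d (T : measurableType d) (R : realType)
    (P : probability T R) (n : nat) (X : 'I_n -> {RV P >-> R}) : Prop :=
  forall (J : {set 'I_n}) (A : 'I_n -> set R),
    (forall i, measurable (A i)) ->
    P (\bigcap_(i in [set` J]) (X i @^-1` A i)) =
      (\prod_(i in J) P (X i @^-1` A i))%E.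

Section Sample.
Context d (T : measurableType d) (R : realType) (P : probability T R).
Context (n : nat) (X : 'I_n -> {RV P >-> R}).

Definition sample_mean (w : T) : R := n%:R^-1 * \sum_(i < n) X i w.

Definition sample_sd (w : T) : R :=
  Num.sqrt ((n%:R - 1)^-1 * \sum_(i < n) (X i w - sample_mean w) ^+ 2).

(* angle between (X_1, ..., X_n) and (1, ..., 1) *)
Definition Phi (w : T) : R :=
  acos ((\sum_(i < n) X i w) /
        (Num.sqrt n%:R * Num.sqrt (\sum_(i < n) X i w ^+ 2))).

Definition tanPhi (w : T) : R := tan (Phi w).

Definition W (t : R) : R := fine (P [set w | tanPhi w <= t]).

(* arccot (sqrt (n - 1)) *)
Definition phi_n : R := atan (1 / Num.sqrt (n%:R - 1)).

Definition Ebar (f : R -> R) : R :=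
  fine ('E_P[fun w => f (Phi w) * \1_[set w | phi_n <= Phi w] w]).

Definition gamma_bar (alpha k : nat) : R :=
  Ebar (fun x => cos x ^+ (alpha * n + k)).

Definition M_bar (alpha k : nat) : R :=
  Ebar (fun x => cot x ^+ (alpha * n + k)).

Definition M_bar_scaled (alpha k : nat) (lambda : R) : R :=
  Ebar (fun x => (lambda^-1 * Num.sqrt n%:R * cot x) ^+ (alpha * n + k)).

Definition Delta_bar (alpha k : nat) (lambda : R) : R :=
  \sum_(l < k.+1) (-1) ^+ l * 'C(k, l)%:R * M_bar_scaled alpha l lambda.

End Sample.

(* Main.v *)
Require Import Defs.
From HB Require Import structures.
From mathcomp Require Import all_boot all_order all_algebra.
From mathcomp Require Import all_classical all_reals all_analysis.
From mathcomp Require Import measurable_realfun.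
From mathcomp Require Import ring lra zify.
Import Order.TTheory GRing.Theory Num.Theory.
Import numFieldNormedType.Exports.
Local Open Scope classical_set_scope.
Local Open Scope ring_scope.

(** Put Y = X_1 + ... + X_n, T = tan Phi, a = alpha n, x = r sqrt n and
    t0 = 1 / sqrt (n - 1). Almost surely all X_i are positive; then T is
    nonnegative, cos Phi = 1 / sqrt (1 + T ^ 2), the condition Phi >= phi_n
    means T >= t0, and sqrt (n - 1) S = Y T / sqrt n ([cosPhi_tan],
    [phi_n_le_tan], [sample_sd_tan]). So the probability is P(Y T <= x).

    The reason for all three formulas is that Y is a gamma variable of order a
    which is independent of T, while the law of T is absolutely continuous
    ([sum_tan_law]). This is proved by adding one variable at a time: if Y and
    V are the sum and the quotient (sum of squares) / (sum) ^ 2 of the first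
    variables and X is the next one, then Y + X and U = X / (Y + X) are
    independent, because their joint density factorises ([gamma_sum_ratio]),
    and the new quotient (1 - U) ^ 2 V + U ^ 2 depends on U and V only
    ([gamma_step]). In the end T = sqrt (n V - 1).

    Split P(Y T <= x) at T = t0. On T < t0, conditioning on T gives the integral
    of G_a (x / t) w(t), and conditioning on Y gives the two terms with W
    ([prob_near_angle], [prob_near_sum]). On T >= t0, conditioning on T gives
    the truncated expectation A of G_a (x / T) ([prob_far]), and each formula
    expands A in a series. For a fixed value t of T, three expansions of
    G_a (x / t) are at hand: expand the exponential in the gamma density, which
    gives powers of cot Phi = 1 / t ([cvg_gamma_cdf_powers]); expand it around
    another rate, which gives gamma distribution functions of higher order
    ([cvg_gamma_cdf_binomial]); or substitute 1 / t = s / sqrt (1 - s ^ 2) with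
    s = cos Phi in the first expansion, expand the powers of 1 - s ^ 2 by the
    negative binomial series and collect equal powers of s, which produces the
    polynomials P_{a,k} ([cvg_gamma_cdf_angle]). For t >= t0 the terms of each
    expansion are bounded by a convergent series of constants, so expectation
    and sum commute ([cvg_series_cos], [cvg_series_cot],
    [cvg_series_difference]). *)

Set Implicit Arguments.
Unset Strict Implicit.
Unset Printing Implicit Defensive.

(** * Double series and negative binomial series *)

Section scalar_facts.
Context {R : realType}.

Lemma cvg_seriesZ (c : R) (u : nat -> R) (l : R) : series u @ \oo --> l ->
  series (fun k => c * u k) @ \oo --> c * l.
Proof.
move=> h; rewrite (_ : series _ = fun n => c * series u n); last first.
  by apply/funext => n; rewrite /series/= big_distrr.
by apply: cvgM => //; exact: cvg_cst.
Qed.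

Lemma fact_neq0 k : k`!%:R != 0 :> R.
Proof. by rewrite pnatr_eq0 -lt0n fact_gt0. Qed.

Lemma norm_exprn_le (a b : R) k : 0 <= a -> a <= b -> `|a ^+ k| <= b ^+ k.
Proof.
move=> a0 ab; rewrite ger0_norm ?exprn_ge0// lerXn2r// ?nnegrE//.
exact: le_trans ab.
Qed.

End scalar_facts.

Section double_series.
Context {R : realType}.
Implicit Types (t : nat -> nat -> R) (tau e : nat -> R).

(** Both sides sum [e k * t k j] over the pairs with [k + c * j < N]; the left one
    groups them along the lines [k + c * j = m], on which [e] is constant. *)
Lemma sum_antidiag t (e : nat -> R) (c N : nat) : (0 < c)%N ->
  (forall k j, e (k + c * j)%N = e k) ->
  \sum_(0 <= m < N) e m * (\sum_(j < (m %/ c).+1) t (m - c * j)%N j) =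
  \sum_(0 <= k < N) e k * (\sum_(0 <= j < N | (k + c * j < N)%N) t k j).
Proof.
move=> c0 he.
(* [G] spreads both sides over one cube of indices, where sums can be exchanged. *)
pose G m k j := (if (k + c * j == m)%N then e k * t k j else 0) : R.
transitivity (\sum_(0 <= m < N) \sum_(0 <= j < N) \sum_(0 <= k < N) G m k j).
  rewrite !big_mkord; apply: eq_bigr => m _.
  rewrite -(big_mkord xpredT (fun j => t (m - c * j)%N j)) big_distrr/=.
  rewrite (big_nat_widen _ _ N); last first.
    by rewrite (leq_ltn_trans (leq_div _ _))// .
  rewrite big_mkcond/=; apply: eq_big_nat => j /andP[_ jN].
  rewrite ltnS leq_divRL// mulnC; case: ifPn => cj.
    rewrite (bigD1_seq (m - c * j)%N)/= ?iota_uniq//; last first.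
      by rewrite mem_index_iota/=; apply: leq_ltn_trans (leq_subr _ _) (ltn_ord m).
    rewrite /G subnK// eqxx big1_seq ?addr0 ?mul1r//; last first.
      move=> k /andP[kN _]; case: eqP => // h; move/eqP: kN.
      by case; rewrite -h addnK.
    by rewrite -{1}(subnK cj) he.
  by rewrite big1_seq// => k _; rewrite /G; case: eqP => // h; move: cj; rewrite -h leq_addl.
rewrite exchange_big/= [LHS](_ : _ = \sum_(0 <= j < N) \sum_(0 <= k < N)
   \sum_(0 <= m < N) G m k j); last first.
  by apply: eq_bigr => j _; rewrite exchange_big.
rewrite exchange_big/=; apply: eq_bigr => k _.
rewrite big_distrr/= [RHS]big_mkcond/=; apply: eq_bigr => j _.
case: ifPn => kjN.
  rewrite (bigD1_seq (k + c * j)%N)/= ?iota_uniq//; last by rewrite mem_index_iota.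
  rewrite {1}/G eqxx big1_seq ?addr0// => m /andP[mk _].
  by rewrite /G eq_sym (negbTE mk).
rewrite big1_seq// => m; rewrite mem_index_iota /= => mN.
by rewrite /G; case: eqP => // h; move: kjN; rewrite h mN.
Qed.

(** Tannery's argument: the [t k j] are nonnegative and the [tau k] summable, so
    the double series may be regrouped along the lines [k + c * j = m]. The weight
    [e] makes room for the signs (-1) ^ k. *)
Lemma cvg_antidiag t tau e (c : nat) (S : R) : (0 < c)%N ->
  (forall k j, e (k + c * j)%N = e k) -> (forall k, `|e k| <= 1) ->
  (forall k j, 0 <= t k j) ->
  (forall k, series (t k) @ \oo --> tau k) ->
  cvgn (series tau) -> series (fun k => e k * tau k) @ \oo --> S ->
  series (fun m => e m * \sum_(j < (m %/ c).+1) t (m - c * j)%N j) @ \oo --> S.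
Proof.
move=> c0 he e1 t0 ht ctau hS.
pose tN (k N : nat) := \sum_(0 <= j < N | (k + c * j < N)%N) t k j.
have st_le k N : series (t k) N <= tau k.
  have nd : nondecreasing_seq (series (t k)).
    by apply/nondecreasing_seqP => m; rewrite seriesSr lerDl.
  have := nondecreasing_cvgn_le nd (cvgP _ (ht k)) N.
  by rewrite (cvg_lim _ (ht k)).
have tN_le k N : tN k N <= tau k.
  apply: le_trans (st_le k N).
  rewrite /tN /series/= big_mkcond/=; apply: ler_sum => j _.
  by case: ifP.
have tN_cvg k : tN k N @[N --> \oo] --> tau k.
  apply/cvgrPdist_le => eps eps0.
  have /cvgrPdist_le/(_ _ eps0) [M _ hM] := ht k.
  near=> N.
  have := hM M (leqnn M).
  rewrite ger0_norm ?subr_ge0// ger0_norm ?subr_ge0//; apply: le_trans.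
  rewrite lerD2l lerN2 /tN /series/=.
  have MN : (M <= N)%N by near: N; exact: nbhs_infty_ge.
  have kMN : (k + c * M <= N)%N by near: N; exact: nbhs_infty_ge.
  rewrite [leRHS](@big_cat_nat _ _ _ M)//= -[leLHS]addr0 lerD//; last by rewrite sumr_ge0.
  rewrite [leRHS]big_mkcond/=; apply: ler_sum_nat => j jM.
  by rewrite (leq_trans _ kMN)// ltn_add2l ltn_mul2l c0 jM.
have tau0 k : 0 <= tau k.
  by apply: le_trans (st_le k 0); rewrite /series/= big_nil.
have rN : \sum_(0 <= k < N) (tau k - tN k N) @[N --> \oo] --> 0.
  apply/cvgrPdist_le => eps eps0.
  have eps2 : 0 < eps / 2 by rewrite divr_gt0.
  have /cauchy_cvgP/cauchy_seriesP/(_ _ eps2) := ctau.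
  move=> [[A B] /= [[a _ hA] [b _ hB]] hAB].
  (* Beyond [K] the tail of [tau] is small; the finitely many k < K are treated
     one by one. *)
  pose K := maxn a b.
  have hK N : (K <= N)%N -> \sum_(K <= k < N) tau k < eps / 2.
    move=> KN; have := hAB (K, N); rewrite /= ger0_norm ?sumr_ge0//; apply.
    split; [apply: hA|apply: hB] => /=; rewrite /K; first exact: leq_maxl.
    exact: leq_trans (leq_maxr _ _) KN.
  have hfin : \sum_(0 <= k < K) (tau k - tN k N) @[N --> \oo] --> 0.
    rewrite [X in _ --> X](_ : 0 = \sum_(0 <= k < K) (tau k - tau k)); last first.
      by rewrite big1// => k _; rewrite subrr.
    apply: cvg_big => [x|k _].
      exact: add_continuous.
    by apply: cvgB; [exact: cvg_cst|exact: tN_cvg].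
  have /cvgrPdist_le/(_ _ eps2) := hfin; rewrite /= => hfin'.
  near=> N.
  rewrite sub0r normrN ger0_norm; last by apply: sumr_ge0 => k _; rewrite subr_ge0.
  have KN : (K <= N)%N by near: N; exact: nbhs_infty_ge.
  rewrite (@big_cat_nat _ _ _ K)//= [leRHS]splitr lerD//.
    have : `|0 - \sum_(0 <= k < K) (tau k - tN k N)| <= eps / 2 by near: N.
    by rewrite sub0r normrN; apply: le_trans; exact: ler_norm.
  apply: le_trans (ltW (hK _ KN)); apply: ler_sum => k _.
  by rewrite gerBl; apply: sumr_ge0.
have diff0 : (\sum_(0 <= k < N) e k * tau k - \sum_(0 <= k < N) e k * tN k N)
     @[N --> \oo] --> 0.
  apply/norm_cvg0P; apply: (squeeze_cvgr _ (cvg_cst 0) rN).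
  near=> N; rewrite normr_ge0/=.
  rewrite -sumrB (le_trans (ler_norm_sum _ _ _))//; apply: ler_sum => k _.
  rewrite -mulrBr normrM [X in _ * X]ger0_norm ?subr_ge0//.
  by rewrite -[leRHS]mul1r ler_wpM2r// subr_ge0.
rewrite [X in X @ _ --> _](_ : _ = (fun N => \sum_(0 <= k < N) e k * tau k -
  (\sum_(0 <= k < N) e k * tau k - \sum_(0 <= k < N) e k * tN k N))); last first.
  by apply/funext => N; rewrite subKr /series/= sum_antidiag.
rewrite -[S]subr0; exact: cvgB.
Unshelve. all: by end_near. Qed.

End double_series.

Section negative_binomial.
Context {R : realType}.
Implicit Types (b c u : R).

(** The coefficient of u ^ j in (1 - u) ^ (- b). *)
Definition rising_binom b j : R := (\prod_(i < j) (b + i%:R)) / j`!%:R.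

Lemma rising_binom0 b : rising_binom b 0 = 1.
Proof. by rewrite /rising_binom big_ord0 divr1. Qed.

Lemma rising_binomS b j :
  j.+1%:R * rising_binom b j.+1 = (b + j%:R) * rising_binom b j.
Proof.
rewrite /rising_binom big_ord_recr/= factS natrM invfM.
set q := _`!%:R^-1; have h : j.+1%:R != 0 :> R by rewrite pnatr_eq0.
by rewrite mulrCA [X in _ * X = _]mulrA divff// mul1r; ring.
Qed.

Lemma rising_binom_ge0 b j : 0 <= b -> 0 <= rising_binom b j.
Proof.
by move=> b0; rewrite divr_ge0// prodr_ge0// => i _; rewrite addr_ge0.
Qed.

Lemma rising_binom_1 j : rising_binom 1 j = 1 :> R.
Proof.
elim: j => [|j ih]; first exact: rising_binom0.
apply: (@mulfI _ j.+1%:R); first by rewrite pnatr_eq0.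
by rewrite rising_binomS ih nat1r.
Qed.

(** Vandermonde's identity, by induction: multiplied by m.+1 = i + (m.+1 - i), both
    sides obey the recursion [rising_binomS]. *)
Lemma rising_binomD b c m :
  \sum_(i < m.+1) rising_binom b i * rising_binom c (m - i)%N =
  rising_binom (b + c) m.
Proof.
elim: m => [|m ih]; first by rewrite big_ord_recl big_ord0 !rising_binom0 addr0 mulr1.
apply: (@mulfI _ m.+1%:R); first by rewrite pnatr_eq0.
rewrite rising_binomS -ih !mulr_sumr.
transitivity (\sum_(i < m.+2) i%:R * rising_binom b i * rising_binom c (m.+1 - i)
  + \sum_(i < m.+2) (m.+1 - i)%:R * rising_binom b i * rising_binom c (m.+1 - i)).
  rewrite -big_split/=; apply: eq_bigr => i _.
  by rewrite -!mulrDl -natrD subnKC ?mulrA// -ltnS.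
rewrite big_ord_recl/= !mul0r add0r [X in _ + X]big_ord_recr/= subnn !mul0r addr0.
rewrite -big_split/=; apply: eq_bigr => i _.
rewrite /bump/= add1n subSS rising_binomS subSn; last by rewrite -ltnS.
rewrite -[X in _ + X]mulrA [X in _ + X]mulrCA rising_binomS natrB; last by rewrite -ltnS.
ring.
Qed.

(** The lines of slope c = 1 in [cvg_antidiag]. *)
Lemma cvg_cauchy_product (a1 a2 : nat -> R) (l1 l2 : R) :
  (forall i, 0 <= a1 i) -> (forall i, 0 <= a2 i) ->
  series a1 @ \oo --> l1 -> series a2 @ \oo --> l2 ->
  series (fun m => \sum_(i < m.+1) a1 i * a2 (m - i)%N) @ \oo --> l1 * l2.
Proof.
move=> a10 a20 h1 h2.
have H := cvg_seriesZ (c := l1) h2.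
have := @cvg_antidiag R (fun k j => a2 k * a1 j) (fun k => l1 * a2 k) (cst 1) 1
  (l1 * l2).
rewrite (_ : (fun m : nat => cst 1 m * \sum_(j < _) _) = (fun m => \sum_(i < m.+1) a1 i * a2 (m - i)%N)).
  apply => //.
  - by move=> k; rewrite /cst normr1.
  - by move=> k j; rewrite mulr_ge0.
  - by move=> k; rewrite mulrC; exact: cvg_seriesZ.
  - exact: cvgP H.
  - rewrite (_ : (fun k => _) = (fun k => l1 * a2 k))//.
    by apply/funext => k; rewrite mul1r.
apply/funext => m; rewrite mul1r divn1; apply: eq_bigr => i _.
by rewrite mul1n mulrC.
Qed.

(** For half-integer exponents the binomial series is a matter of algebra: by
    [rising_binomD] the series of exponent 1 / 2 squares to the geometric series,
    and the other ones are its powers. *)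
Lemma cvg_negative_binomial u p : 0 <= u -> u < 1 ->
  series (fun j => rising_binom (p%:R / 2) j * u ^+ j) @ \oo -->
  (Num.sqrt (1 - u))^-1 ^+ p.
Proof.
move=> u0 u1.
have t0 q j : 0 <= rising_binom (q%:R / 2) j * u ^+ j.
  by rewrite mulr_ge0 ?exprn_ge0 ?rising_binom_ge0// divr_ge0.
have conv (b c : R) m : \sum_(i < m.+1)
    (rising_binom b i * u ^+ i) * (rising_binom c (m - i)%N * u ^+ (m - i)) =
    rising_binom (b + c) m * u ^+ m.
  rewrite -rising_binomD mulr_suml; apply: eq_bigr => i _.
  have -> : u ^+ m = u ^+ i * u ^+ (m - i) by rewrite -exprD subnKC// -ltnS.
  ring.
have geo : series (fun j => u ^+ j) @ \oo --> (1 - u)^-1.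
  have := @cvg_geometric_series R 1 u; rewrite ger0_norm// => /(_ u1).
  rewrite mul1r (_ : geometric 1 u = fun j => u ^+ j)//.
  by apply/funext => j; rewrite /geometric/= mul1r.
(* The geometric series dominates, which gives convergence. *)
have half_le j : rising_binom (1 / 2) j <= 1 :> R.
  elim: j => [|j ih]; first by rewrite rising_binom0.
  rewrite -(@ler_pM2l _ j.+1%:R) ?ltr0n// rising_binomS mulr1.
  rewrite -[leRHS]mulr1 ler_pM ?rising_binom_ge0 ?addr_ge0//.
  by rewrite -[j.+1%:R]natr1 addrC lerD2l; lra.
have half : series (fun j => rising_binom (1%:R / 2) j * u ^+ j) @ \oo -->
   (Num.sqrt (1 - u))^-1.
  have cv : cvgn (series (fun j => rising_binom (1%:R / 2) j * u ^+ j)).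
    apply: (series_le_cvg _ _ _ (cvgP _ geo)) => j; first exact: t0.
      by rewrite exprn_ge0.
    by rewrite -[leRHS]mul1r ler_wpM2r ?exprn_ge0.
  set l := limn _ in cv.
  have sq : l * l = (1 - u)^-1.
    have := @cvg_cauchy_product _ _ l l (t0 1%N) (t0 1%N) cv cv.
    rewrite (_ : (fun m : nat => _) = fun j => u ^+ j).
      by move=> h; exact: (cvg_unique _ h geo).
    apply/funext => m; rewrite conv -splitr rising_binom_1 mul1r//.
  have l0 : 0 <= l.
    by apply: limr_ge => //; near=> n; rewrite /series/= sumr_ge0.
  rewrite (_ : (Num.sqrt (1 - u))^-1 = l)//.
  by rewrite -sqrtrV ?subr_ge0 ?ltW// -sq -expr2 sqrtr_sqr ger0_norm.
elim: p => [|p ih].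
  rewrite expr0; apply: cvg_near_cst; near=> n.
  rewrite /series/= -(@prednK n); last by near: n; exact: nbhs_infty_gt.
  rewrite big_nat_recl// rising_binom0 expr0 mulr1 big1_seq ?addr0// => j _.
  rewrite /rising_binom big_ord_recl/= mul0r addr0 !mul0r//.
rewrite exprS.
have := cvg_cauchy_product (t0 1%N) (t0 p) half ih.
rewrite (_ : (fun m : nat => _) =
  (fun j : nat => rising_binom (p.+1%:R / 2) j * u ^+ j))//.
apply/funext => m; rewrite conv; congr (rising_binom _ _ * _).
by rewrite -mulrDl nat1r.
Unshelve. all: by end_near. Qed.

End negative_binomial.

(** * Termwise integration, densities and null sets *)

Lemma measurable_inv {R : realType} : measurable_fun setT (fun x : R => x^-1).
Proof.
have mN0 : measurable (~` [set (0 : R)]) by exact: measurableC.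
rewrite -(setUv [set (0 : R)]); apply/measurable_funU => //; split.
  exact: measurable_fun_set1.
apply: open_continuous_measurable_fun.
  by apply: closed_openC; exact: closed_eq.
move=> x; rewrite inE/= => /eqP x0; exact: inv_continuous.
Qed.

Lemma Rintegral_sum d (T : measurableType d) (R : realType)
    (mu : {measure set T -> \bar R}) (D : set T) (I : Type) (s : seq I)
    (f : I -> T -> R) : measurable D ->
  (forall i, mu.-integrable D (EFin \o f i)) ->
  \int[mu]_(x in D) (\sum_(i <- s) f i x) = \sum_(i <- s) \int[mu]_(x in D) f i x.
Proof.
move=> mD intf; rewrite /Rintegral sum_fine; last first.
  by move=> i _; exact: (integrable_fin_num mD (intf i)).
rewrite -(integral_sum mD intf); congr fine; apply: eq_integral => x _.
by rewrite -sumEFin.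
Qed.

Section termwise_integration.
Context d (T : measurableType d) (R : realType) (mu : {measure set T -> \bar R}).

Lemma bounded_integrable (D : set T) (f : T -> R) (M : R) : measurable D ->
  (mu D < +oo)%E -> measurable_fun D f -> (forall x, D x -> `|f x| <= M) ->
  mu.-integrable D (EFin \o f).
Proof.
move=> mD Doo mf fM; apply: measurable_bounded_integrable => //.
exists M; split; first exact: num_real.
by move=> x Mx y /= Dy; apply: le_trans (fM _ Dy) _; exact: ltW.
Qed.

(** Dominated convergence for the partial sums, all of which are bounded by the sum
    of [b]. *)
Lemma cvg_series_Rintegral (D : set T) (f : nat -> T -> R) (F : T -> R)
    (b : nat -> R) : measurable D -> (mu D < +oo)%E ->
  (forall k, measurable_fun D (f k)) ->
  (forall k x, D x -> `|f k x| <= b k) -> cvgn (series b) ->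
  (forall x, D x -> series (f ^~ x) @ \oo --> F x) ->
  series (fun k => \int[mu]_(x in D) f k x) @ \oo --> \int[mu]_(x in D) F x.
Proof.
move=> mD Doo mf fb cb fF.
have [->|D0] := eqVneq D set0.
  rewrite Rintegral_set0; apply: cvg_near_cst; apply: nearW => n.
  by rewrite /series/= big1// => k _; rewrite Rintegral_set0.
have [x0 Dx0] : exists x, D x by apply/set0P.
have b0 k : 0 <= b k by apply: le_trans (fb k _ Dx0).
have ms n : measurable_fun D (fun x => series (f ^~ x) n).
  by apply: measurable_sum.
have mF : measurable_fun D F by exact: measurable_fun_cvg fF.
have fint k : mu.-integrable D (EFin \o f k).
  by apply: (@bounded_integrable _ _ (b k)) => // x; exact: fb.
have sB n x : D x -> `|series (f ^~ x) n| <= limn (series b).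
  move=> Dx; apply: (@le_trans _ _ (series b n)).
    by rewrite (le_trans (ler_norm_sum _ _ _))//; apply: ler_sum => k _; exact: fb.
  apply: nondecreasing_cvgn_le => //.
  by apply/nondecreasing_seqP => m; rewrite seriesSr lerDl.
have dcv := @dominated_convergence _ _ _ mu D mD
  (fun n x => (series (f ^~ x) n)%:E) (EFin \o F) (cst (limn (series b))%:E)
  (fun n => proj2 (measurable_EFinP _ _) (ms n))
  (proj2 (measurable_EFinP _ _) mF).
have {dcv}[|||_ _] := dcv.
- by apply: aeW => x Dx; apply: cvg_EFin; [exact: nearW|exact: fF].
- apply: (@bounded_integrable _ (cst (limn (series b))) `|limn (series b)|) => //.
- by apply: aeW => x n Dx; rewrite lee_fin; exact: sB.
rewrite (_ : (fun n => _) = fun n => (series (fun k => \int[mu]_(x in D) f k x) n)%:E);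
  last first.
  apply/funext => n; rewrite /series/=.
  under eq_integral do rewrite -sumEFin.
  rewrite integral_sum//.
  rewrite -[RHS]sumEFin; apply: eq_bigr => k _; rewrite /Rintegral fineK//.
  exact: integrable_fin_num (fint k).
have Fint : mu.-integrable D (EFin \o F).
  apply: (@bounded_integrable _ _ (limn (series b))) => // x Dx.
  have : `|series (f ^~ x) n| @[n --> \oo] --> `|F x| by apply: cvg_norm; exact: fF.
  move=> h; rewrite -(cvg_lim _ h)//; apply: limr_le; first exact: cvgP h.
  by apply: nearW => n; exact: sB.
have H : (\int[mu]_(x in D) (F x)%:E = (\int[mu]_(x in D) F x)%:E)%E.
  by rewrite /Rintegral fineK//; exact: integrable_fin_num Fint.
by rewrite H => /fine_cvgP[_]; apply.
Qed.

End termwise_integration.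

Section density.
Context {R : realType}.
Local Notation mu := (@lebesgue_measure R).

(** [f] agrees almost everywhere with the Radon-Nikodym derivative of [nu], which
    has the change of measure property. *)
Lemma ge0_integral_density (nu : {finite_measure set (measurableTypeR R) -> \bar R})
    (f : R -> R) (D : set R) (h : R -> \bar R) :
  measurable_fun setT f -> (forall x, 0 <= f x) ->
  (forall A, measurable A -> nu A = \int[mu]_(x in A) (f x)%:E)%E ->
  measurable D -> measurable_fun D h -> (forall x, 0 <= h x)%E ->
  (\int[nu]_(x in D) h x = \int[mu]_(x in D) (h x * (f x)%:E))%E.
Proof.
move=> mf f0 nuE mD mh h0.
have dom : nu `<< mu.
  apply/null_content_dominatesP => A mA A0.
  by rewrite nuE//; apply: null_set_integral => //; apply/measurable_EFinP; exact: measurable_funTS.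
rewrite -(Radon_Nikodym_SigmaFinite.change_of_variables dom)//.
have mrn := measurable_int _ (Radon_Nikodym_SigmaFinite.f_integrable dom).
apply: ae_eq_integral => //.
- by apply: emeasurable_funM => //; exact: measurable_funTS.
- by apply: emeasurable_funM => //; apply/measurable_EFinP; exact: measurable_funTS.
- apply: ae_eqe_mul2l; apply: integral_ae_eq => //.
  + by apply: (integrableS measurableT) => //; exact: Radon_Nikodym_SigmaFinite.f_integrable.
  + by apply/measurable_EFinP; exact: measurable_funTS.
  + move=> E ED mE; rewrite -nuE//.
    by rewrite -Radon_Nikodym_SigmaFinite.f_integral.
Qed.

End density.

Section change_of_variables.
Context {R : realType}.
Local Notation mu := (@lebesgue_measure R).

Lemma measurable_affine (c b : R) :
  measurable_fun setT (fun x => c * x + b : measurableTypeR R).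
Proof. by apply: measurable_funD => //; exact: measurable_funM. Qed.

(** Up to the factor [c] the left side is a measure which agrees with Lebesgue
    measure on intervals. *)
Lemma lebesgue_measure_affine (c b : R) (A : set R) : 0 < c -> measurable A ->
  mu ((fun x => c * x + b) @^-1` A) = ((c^-1)%:E * mu A)%E.
Proof.
move=> c0 mA.
pose phi (x : measurableTypeR R) : measurableTypeR R := c * x + b.
have mphi : measurable_fun setT phi by exact: measurable_affine.
have c0' : 0 <= c by exact: ltW.
have /(_ mphi _ mA) : forall A, measurable A ->
    mu A = mscale (NngNum c0') (pushforward mu phi) A.
  move=> m; apply: lebesgue_measure_unique => _ [[x y]] _ <-.
  rewrite [RHS]/(_ * mu (phi @^-1` `]x, y]%classic))%E.
  have -> : phi @^-1` `]x, y]%classic = `](x - b) / c, (y - b) / c]%classic.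
    apply/seteqP; split => z /=; rewrite /phi !in_itv/= ltr_pdivrMr// ler_pdivlMr//;
      by rewrite ltrBlDr lerBrDr mulrC.
  rewrite !lebesgue_measure_itv/= !lte_fin ltr_pM2r ?invr_gt0// ltrD2r.
  case: ifPn => xy; last by rewrite /= mulr0.
  rewrite -EFinD; congr EFin; by field; rewrite gt_eqF.
rewrite /mscale/= => ->; rewrite muleA -EFinM mulVf ?gt_eqF// mul1e//.
Qed.

Lemma ge0_integral_affine (c b : R) (f : R -> \bar R) : 0 < c ->
  measurable_fun setT f -> (forall x, 0 <= f x)%E ->
  (\int[mu]_x f (c * x + b)%R = (c^-1)%:E * \int[mu]_x f x)%E.
Proof.
move=> c0 mf f0.
have ic0 : 0 <= c^-1 by rewrite invr_ge0 ltW.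
rewrite (_ : (c^-1)%:E = ((NngNum ic0)%:num)%:E)//.
rewrite -ge0_integral_mscale//.
rewrite -(@ge0_integral_pushforward _ _ _ _ R (fun x : measurableTypeR R => c * x + b : measurableTypeR R) (measurable_affine c b) mu setT f)//.
apply: eq_measure_integral => [|m A mA _]; first exact: measurable_affine.
exact: (lebesgue_measure_affine b c0 mA).
Qed.

Lemma null_affine (c b : R) (N : set R) : 0 < c -> measurable N -> mu N = 0%E ->
  mu ((fun x => c * x + b) @^-1` N) = 0%E.
Proof. by move=> c0 mN N0; rewrite lebesgue_measure_affine// N0 mule0. Qed.

Lemma FTC_is_derive (f F : R -> R) (a b : R) : a < b -> continuous f ->
  (forall x : R, is_derive x 1 F (f x)) ->
  (\int[mu]_(x in `[a, b]) (f x)%:E = (F b - F a)%:E)%E.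
Proof.
move=> ab cf dF.
have cF x : {for x, continuous F}.
  by apply: differentiable_continuous; apply/derivable1_diffP; exact: ex_derive.
rewrite (continuous_FTC2 ab _ (F := F)) ?EFinB//.
- exact: continuous_subspaceT.
- split; first by move=> x _; exact: ex_derive.
  + exact/cvg_at_right_filter/cF.
  + exact/cvg_at_left_filter/cF.
- by move=> x _; rewrite derive1E derive_val.
Qed.

End change_of_variables.

Section density_measure.
Context {R : realType}.
Local Notation mu := (@lebesgue_measure R).

Section with_density.
Context (g : R -> R).
(** The proofs are arguments of the function, so that its measure structure is
    found from the head symbol. *)
Definition with_density (mg : measurable_fun setT g) (g0 : forall x, 0 <= g x)
    (A : set (measurableTypeR R)) : \bar R := (\int[mu]_(x in A) (g x)%:E)%E.

Context (mg : measurable_fun setT g) (g0 : forall x, 0 <= g x).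
Local Notation nu := (with_density mg g0).

Let with_density0 : nu set0 = 0%E.
Proof. by rewrite /with_density integral_set0. Qed.

Let with_density_ge0 A : (0 <= nu A)%E.
Proof. by apply: integral_ge0 => x _; rewrite lee_fin. Qed.

Let with_density_sigma_additive : semi_sigma_additive nu.
Proof.
move=> /= F mF tF mUF; rewrite /with_density ge0_integral_bigcup//=.
- by apply: is_cvg_ereal_nneg_natsum_cond => n _ _; exact: with_density_ge0.
- by apply/measurable_EFinP; exact: measurable_funTS.
- by move=> x _; rewrite lee_fin.
Qed.

HB.instance Definition _ := isMeasure.Build _ _ _ nu
  with_density0 with_density_ge0 with_density_sigma_additive.

End with_density.

Let g (u : R) : R := Num.max 0 (2 * u).

Let mg : measurable_fun setT g.
Proof. by apply: measurable_maxr => //; exact: measurable_funM. Qed.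

Let g0 u : 0 <= g u. Proof. by rewrite /g le_max lexx. Qed.

Let sq (u : measurableTypeR R) : measurableTypeR R := (u : R) ^+ 2.

Let msq : measurable_fun setT sq.
Proof. exact: exprn_measurable. Qed.

Let int_g (a b : R) : 0 <= a -> a <= b ->
  (\int[mu]_(u in `]a, b]) (g u)%:E = (b ^+ 2 - a ^+ 2)%:E)%E.
Proof.
move=> a0; rewrite le_eqVlt => /predU1P[<-|ab].
  by rewrite subrr set_itv_ge ?integral_set0// bnd_simp ltxx.
rewrite integral_itv_obnd_cbnd; last by apply/measurable_EFinP; exact: measurable_funTS.
have dF (u : R) : is_derive u 1 (fun u => u ^+ 2) (2 * u).
  by apply: is_derive_eq; rewrite /GRing.scale/= !mulr1; ring.
rewrite -(FTC_is_derive ab _ dF).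
- apply: eq_integral => u; rewrite inE/= in_itv/= => /andP[au _].
  by rewrite /g max_r// mulr_ge0// (le_trans a0).
- exact: mulrl_continuous.
Qed.

(** Nothing is moved on the negative half-line; on the positive one this is the
    substitution w = u ^ 2, with Jacobian 2 u. Both sides are measures in [A], so
    that intervals suffice. *)
Lemma lebesgue_measure_sqr (A : set R) : measurable A ->
  (mu A = mu (A `&` `]-oo, 0%R[) + \int[mu]_(u in sq @^-1` A) (g u)%:E)%E.
Proof.
move=> mA.
have neg : measurable (`]-oo, 0%R[%classic : set (measurableTypeR R)) by exact: measurable_itv.
have /(_ msq _ mA) : forall A, measurable A ->
  mu A = measure_add (mrestr mu neg) (pushforward (with_density mg g0) sq) A.
  move=> m; apply: lebesgue_measure_unique => _ [[x y]] _ <-.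
  apply: etrans; last exact/esym/measure_addE.
  rewrite /= [RHS](_ : _ = mu (`]x, y] `&` `]-oo, 0%R[) +
    \int[mu]_(u in sq @^-1` `]x, y]) (g u)%:E)%E//.
  have [yx|xy] := leP y x.
    rewrite set_itv_ge ?bnd_simp -?leNgt// set0I preimage_set0.
    by rewrite integral_set0 measure0 adde0.
  have -> : (\int[mu]_(u in sq @^-1` `]x, y]) (g u)%:E =
             \int[mu]_(u in sq @^-1` `]x, y] `&` `]0%R, +oo[) (g u)%:E)%E.
    rewrite integral_mkcond [RHS]integral_mkcond; apply: eq_integral => u _.
    rewrite !patchE in_setI; case: (u \in sq @^-1` _) => //=.
    case: ifPn => //; rewrite notin_setE/= in_itv/= andbT => /negP.
    by rewrite -leNgt => u0; rewrite /g max_l// mulr_ge0_le0.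
  have sqE (u : R) : 0 < u -> Num.sqrt (u ^+ 2) = u.
    by move=> u0; rewrite sqrtr_sqr gtr0_norm.
  have lt_sq (z u : R) : 0 < u -> (z < u ^+ 2) = (Num.sqrt z < u).
    by move=> u0; rewrite -{2}(sqE u u0) ltr_sqrt// exprn_gt0.
  have le_sq (z u : R) : 0 < u -> (u ^+ 2 <= z) = (u <= Num.sqrt z).
    by move=> u0; rewrite leNgt lt_sq// -leNgt.
  have [y0|y0] := ltP y 0.
    rewrite [X in (_ + X)%E](_ : _ = 0%E).
      by rewrite adde0 setIidl// => u/=; rewrite !in_itv/= => /andP[_ /le_lt_trans]; apply.
    rewrite (_ : _ `&` _ = set0) ?integral_set0//.
    apply/seteqP; split => u //=; rewrite !in_itv/= andbT /sq => -[/andP[_ h] _].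
    by have := le_lt_trans h y0; rewrite ltNge sqr_ge0.
  have [x0|x0] := leP 0 x.
    rewrite (_ : `]x, y] `&` `]-oo, 0%R[ = set0) ?measure0 ?add0e; last first.
      apply/seteqP; split => u //=; rewrite !in_itv/= => -[/andP[xu _] u0].
      by have := le_lt_trans x0 (lt_trans xu u0); rewrite ltxx.
    rewrite (_ : _ `&` _ = `]Num.sqrt x, Num.sqrt y]%classic); last first.
      apply/seteqP; split => u /=; rewrite !in_itv/= andbT /sq.
        by move=> [/andP[h1 h2] u0]; rewrite -lt_sq// -le_sq// h1.
      move=> /andP[h1 h2]; have u0 : 0 < u by exact: le_lt_trans h1.
      by rewrite lt_sq// le_sq// h1.
    rewrite int_g ?sqrtr_ge0 ?ler_sqrt ?(ltW xy)// !sqr_sqrtr//.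
    by rewrite lebesgue_measure_itv/= lte_fin xy EFinB.
  rewrite (_ : `]x, y] `&` `]-oo, 0%R[ = `]x, 0[%classic); last first.
    apply/seteqP; split => u /=; rewrite !in_itv/=.
      by move=> [/andP[-> _] ->].
    by move=> /andP[-> u0]; split=> //=; rewrite (le_trans (ltW u0)).
  rewrite (_ : _ `&` _ = `]0, Num.sqrt y]%classic); last first.
    apply/seteqP; split => u /=; rewrite !in_itv/= andbT /sq.
      by move=> [/andP[h1 h2] u0]; rewrite -le_sq// u0.
    move=> /andP[u0 h2]; rewrite le_sq// h2 u0; split => //.
    by rewrite (lt_trans x0)// exprn_gt0.
  rewrite int_g ?sqrtr_ge0// sqr_sqrtr// expr0n subr0.
  by rewrite !lebesgue_measure_itv/= !lte_fin xy x0 -!EFinD; congr EFin; ring.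
by move=> ->; rewrite measure_addE.
Qed.

(** By [lebesgue_measure_sqr] the integral of 2 u over the positive part of the
    preimage vanishes, so this part is null; the negative part is its mirror image. *)
Lemma null_preimage_sqr (N : set R) : measurable N -> mu N = 0%E ->
  mu ((fun u : R => u ^+ 2) @^-1` N) = 0%E.
Proof.
move=> mN N0.
have mS : measurable (sq @^-1` N) by rewrite -[X in measurable X]setTI; exact: msq.
have := lebesgue_measure_sqr mN; rewrite N0 => /esym/eqP.
rewrite padde_eq0 ?integral_ge0// => [/andP[_ /eqP Ig]|x _]; last by rewrite lee_fin.
have pos0 : mu.-negligible (sq @^-1` N `&` `]0, +oo[).
  have /(ae_eq_integral_abs mu mS)[|B [mB B0 hB]] : (\int[mu]_(u in sq @^-1` N) `|(g u)%:E| = 0)%E.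
    by rewrite -[RHS]Ig; apply: eq_integral => u _; rewrite gee0_abs// lee_fin.
    by apply/measurable_EFinP; exact: measurable_funTS.
  exists B; split => // u [/= Nu]; rewrite in_itv/= andbT => u0.
  apply: hB => /= /(_ Nu)/(congr1 fine)/=/eqP.
  by rewrite /g max_r ?mulf_eq0 ?pnatr_eq0 ?gt_eqF// mulr_ge0// ltW.
have mP : measurable (sq @^-1` N `&` `]0, +oo[) by exact: measurableI.
have neg0 : mu.-negligible ((-%R : R -> measurableTypeR R) @^-1` (sq @^-1` N `&` `]0, +oo[)).
  apply/negligibleP.
    by rewrite -[X in measurable X]setTI; exact: oppr_measurable.
  rewrite [LHS](lebesgue_measureN mP).
  exact/negligibleP.
have zero0 : mu.-negligible [set (0 : R)].
  by apply/negligibleP => //; exact: lebesgue_measure_set1.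
apply: measure_negligible => //.
apply: negligibleS (negligibleU pos0 (negligibleU neg0 zero0)) => u /= Nu.
have [u0|u0|->] := ltgtP u 0; last by right; right.
  by right; left => /=; rewrite /sq sqrrN in_itv/= oppr_gt0 u0.
by left => /=; rewrite in_itv/= u0.
Qed.

(** By [lebesgue_measure_sqr] the measure of this set is the integral of 2 u over
    the positive part of [N]. *)
Lemma null_preimage_sqrt (N : set R) : measurable N -> mu N = 0%E ->
  mu ([set w : R | 0 <= w] `&` Num.sqrt @^-1` N) = 0%E.
Proof.
move=> mN N0; set S := _ `&` _.
have mS : measurable S.
  apply: measurableI.
    by rewrite -set_itvcy; exact: measurable_itv.
  rewrite -[X in measurable X]setTI.
  by apply: continuous_measurable_fun => //; exact: sqrt_continuous.
rewrite lebesgue_measure_sqr//.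
rewrite (_ : S `&` _ = set0); last first.
  apply/seteqP; split => u //=; rewrite in_itv/= => -[[/= u0 _]].
  by rewrite ltNge u0.
rewrite measure0 add0e.
rewrite integral_mkcond (_ : (fun u => (g u)%:E) \_ _ = (fun u => (g u)%:E) \_ N).
  rewrite -integral_mkcond; apply: null_set_integral => //.
  by apply/measurable_EFinP; exact: measurable_funTS.
apply/funext => u; rewrite !patchE.
have [u0|u0] := leP 0 u; last first.
  by rewrite /g max_l ?if_same// mulr_ge0_le0// ltW.
congr (if _ then _ else _); apply/idP/idP; rewrite !inE/S/sq/= sqrtr_sqr ger0_norm//.
  by case.
by split => //; exact: sqr_ge0.
Qed.
End density_measure.

(** * Gamma densities and their distribution functions *)

Section gamma_function.
Context {R : realType}.
Local Notation mu := (@lebesgue_measure R).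

(** An antiderivative of x ^ m * exp (- x), found by repeated integration by parts. *)
Fixpoint gamma_primitive (m : nat) (x : R) : R :=
  match m with
  | 0%N => - expR (- x)
  | m'.+1 => - (x ^+ m * expR (- x)) + m%:R * gamma_primitive m' x
  end.

Lemma is_derive_expRN (c x : R) :
  is_derive x 1 (fun t => expR (- (c * t))) (- c * expR (- (c * x))).
Proof.
have h : is_derive x 1 (fun t : R => - (c * t)) (- c).
  by apply: is_derive_eq; rewrite /GRing.scale/= mulr1.
have := @is_derive1_comp R expR (fun t : R => - (c * t)) x _ _ (is_derive_expR (- (c * x))) h.
by rewrite mulrC.
Qed.

Lemma is_derive_exprS m (x : R) :
  is_derive x 1 (fun t : R => t ^+ m.+1) (m.+1%:R * x ^+ m).
Proof.
have := is_deriveX m.+1 (is_derive_id x (1 : R)).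
rewrite (_ : id ^+ m.+1 = fun t : R => t ^+ m.+1); last by rewrite exprfctE.
by move=> h; apply: (is_derive_eq h); rewrite /GRing.scale/= mulr1.
Qed.

Lemma is_derive_gamma_primitive m (x : R) :
  is_derive x 1 (gamma_primitive m) (x ^+ m * expR (- x)).
Proof.
have dexp : is_derive x 1 (fun t : R => expR (- t)) (- expR (- x)).
  have := is_derive_expRN 1 x; rewrite mul1r mulN1r.
  by under eq_fun do rewrite mul1r.
elim: m => [|m ih].
  by rewrite expr0 mul1r /=; apply: is_derive_eq; rewrite opprK.
have dX : is_derive x 1 (fun t : R => t ^+ m.+1) (m.+1%:R * x ^+ m).
  exact: is_derive_exprS.
have dXe := is_deriveM dX dexp.
have dF := is_deriveD (is_deriveN dXe) (is_deriveZ m.+1%:R ih).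
by apply: (is_derive_eq dF); rewrite /GRing.scale/=; ring.
Qed.

Lemma gamma_primitive0 m : gamma_primitive m 0 = - m`!%:R.
Proof.
elim: m => [|m ih] /=; first by rewrite oppr0 expR0.
by rewrite ih exprS !mul0r oppr0 add0r mulrN -natrM factS.
Qed.

Lemma cvg_gamma_primitive m : gamma_primitive m x @[x --> +oo] --> 0.
Proof.
have pe k : x ^+ k * expR (- x) @[x --> +oo] --> (0 : R).
  apply/cvgrPdist_le => e e0; near=> x.
  have x0 : 0 < x by near: x; apply: nbhs_pinfty_gt; exact: num_real.
  rewrite sub0r normrN ger0_norm ?mulr_ge0 ?exprn_ge0 ?expR_ge0 ?(ltW x0)//.
  rewrite expRN ler_pdivrMr ?expR_gt0//.
  have h : x ^+ k.+1 / k.+1`!%:R <= expR x.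
    by rewrite (le_trans _ (expR_ge1Dxn k (ltW x0)))// lerDr.
  rewrite -(@ler_pM2l _ (x / k.+1`!%:R)) ?divr_gt0 ?ltr0n ?fact_gt0//.
  rewrite mulrAC -exprS (le_trans h)// mulrA ler_peMl ?expR_ge0//.
  have : k.+1`!%:R / e <= x by near: x; apply: nbhs_pinfty_ge; exact: num_real.
  by rewrite ler_pdivrMr// => hx; rewrite mulrAC ler_pdivlMr ?mul1r// ltr0n fact_gt0.
elim: m => [|m ih].
  have := pe 0%N; under eq_cvg do rewrite expr0 mul1r.
  by move=> h; rewrite -oppr0; exact: cvgN.
rewrite [X in _ --> X](_ : 0 = - 0 + m.+1%:R * 0); last by rewrite oppr0 mulr0 addr0.
by apply: cvgD; [apply: cvgN; exact: pe|apply: cvgM => //; exact: cvg_cst].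
Unshelve. all: by end_near. Qed.

Lemma continuous_expM (c : R) m : continuous (fun x : R => x ^+ m * expR (- (c * x))).
Proof.
move=> x; apply: cvgM; first exact: exprn_continuous.
apply: (@cvg_comp _ _ _ (fun t : R => - (c * t)) expR _ (nbhs (- (c * x)))).
  by apply: cvgN; exact: mulrl_continuous.
exact: continuous_expR.
Qed.

Lemma integral_gamma m :
  (\int[mu]_(x in `]0%R, +oo[) (x ^+ m * expR (- x))%:E = (m`!%:R)%:E)%E.
Proof.
have cf : continuous (fun x : R => x ^+ m * expR (- x)).
  by have := @continuous_expM 1 m; under eq_fun do rewrite mul1r.
rewrite integral_itv_obnd_cbnd; last first.
  apply/measurable_EFinP; apply: measurable_funTS; exact: continuous_measurable_fun.
have dF x := is_derive_gamma_primitive m x.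
rewrite (@ge0_continuous_FTC2y _ _ (gamma_primitive m) 0 0).
- by rewrite gamma_primitive0 -EFinB opprK add0r.
- by move=> x x0; rewrite mulr_ge0 ?exprn_ge0 ?expR_ge0.
- exact: continuous_subspaceT.
- exact: cvg_gamma_primitive.
- by move=> x _; exact: ex_derive.
- apply: cvg_at_right_filter; apply: differentiable_continuous.
  by apply/derivable1_diffP; exact: ex_derive.
- by move=> x _; rewrite derive1E derive_val.
Qed.

Lemma powR_natB1 m (x : R) : 0 <= x -> x `^ (m.+1%:R - 1) = x ^+ m.
Proof. by move=> x0; rewrite -natr1 addrK powR_mulrn. Qed.

Lemma Gamma_nat m : Gamma (m.+1%:R : R) = m`!%:R.
Proof.
rewrite /Gamma /Rintegral.
rewrite (_ : m`!%:R = fine (m`!%:R%:E))// -integral_gamma; congr fine.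
apply: eq_integral => x; rewrite inE/= in_itv/= andbT => x0.
by rewrite powR_natB1 ?ltW.
Qed.

Lemma gamma_pdfE m (x : R) : 0 < x ->
  gamma_pdf m.+1%:R x = x ^+ m * expR (- x) / m`!%:R.
Proof. by move=> x0; rewrite /gamma_pdf x0 Gamma_nat powR_natB1 ?ltW. Qed.

Lemma gamma_pdf_le0 b (x : R) : x <= 0 -> gamma_pdf b x = 0.
Proof. by move=> x0; rewrite /gamma_pdf ltNge x0. Qed.

Lemma gamma_pdf_ge0 m (x : R) : 0 <= gamma_pdf m.+1%:R x.
Proof.
have [x0|x0] := leP x 0; first by rewrite gamma_pdf_le0.
by rewrite gamma_pdfE// divr_ge0// mulr_ge0 ?expR_ge0// exprn_ge0// ltW.
Qed.

Lemma gamma_pdf_patch m : gamma_pdf m.+1%:R =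
  (fun x : R => x ^+ m * expR (- x) / m`!%:R) \_ `]0, +oo[.
Proof.
apply/funext => x; rewrite patchE; case: ifPn => [|].
  by rewrite inE/= in_itv/= andbT => x0; rewrite gamma_pdfE.
rewrite notin_setE/= in_itv/= andbT => /negP; rewrite -leNgt => x0.
by rewrite gamma_pdf_le0.
Qed.

Lemma measurable_gamma_pdf m : measurable_fun setT (gamma_pdf m.+1%:R : R -> R).
Proof.
rewrite gamma_pdf_patch; apply/(measurable_restrictT _ _).1 => //.
apply: measurable_funTS; apply: measurable_funM => //.
apply: continuous_measurable_fun.
by have := @continuous_expM 1 m; under eq_fun do rewrite mul1r.
Qed.

Lemma integral_gamma_pdf m : (\int[mu]_x (gamma_pdf m.+1%:R x)%:E = 1)%E.
Proof.
rewrite gamma_pdf_patch.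
rewrite -[LHS]/(\int[mu]_x ((EFin \o (_ \_ _)) x))%E -restrict_EFin -integral_mkcond/=.
under eq_integral do rewrite EFinM.
rewrite ge0_integralZr//.
- by rewrite integral_gamma -EFinM divff// pnatr_eq0 -lt0n fact_gt0.
- apply/measurable_EFinP; apply: measurable_funTS; apply: continuous_measurable_fun.
  by have := @continuous_expM 1 m; under eq_fun do rewrite mul1r.
- move=> x /=; rewrite in_itv/= andbT lee_fin => x0.
  by rewrite mulr_ge0 ?expR_ge0// exprn_ge0// ltW.
Qed.

End gamma_function.

Section gamma_cdf.
Context {R : realType}.
Local Notation mu := (@lebesgue_measure R).

(** The incomplete gamma integral, with an explicit rate because the expansions
    below pass from one rate to another. *)
Definition gamma_lower (m : nat) (c y : R) : R :=
  \int[mu]_(t in `[0, y]) (t ^+ m * expR (- (c * t))).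

Lemma integrable_expM (c : R) m y :
  mu.-integrable `[0, y] (EFin \o (fun t : R => t ^+ m * expR (- (c * t)))).
Proof.
apply: continuous_compact_integrable; first exact: segment_compact.
apply: continuous_subspaceT; exact: continuous_expM.
Qed.

Lemma gamma_lower0 m y : 0 <= y -> gamma_lower m 0 y = y ^+ m.+1 / m.+1%:R.
Proof.
rewrite le_eqVlt => /predU1P[<-|y0].
  by rewrite /gamma_lower set_itv1 Rintegral_set1 exprS !mul0r.
rewrite /gamma_lower /Rintegral.
under eq_integral do rewrite mul0r oppr0 expR0 mulr1.
have dF (x : R) : is_derive x 1 (fun t => m.+1%:R^-1 * t ^+ m.+1) (x ^+ m).
  apply: (is_derive_eq (is_deriveZ m.+1%:R^-1 (is_derive_exprS m x))).
  by rewrite /GRing.scale/= mulrA mulVf ?mul1r.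
have cX : continuous (fun x : R => x ^+ m) by exact: exprn_continuous.
by rewrite (FTC_is_derive y0 cX dF) /= expr0n/= mulr0 subr0 mulrC.
Qed.

(** The substitution s = c t, carried out on antiderivatives. *)
Lemma gamma_lower_scale m c y : 0 < c -> 0 <= y ->
  gamma_lower m 1 (c * y) = c ^+ m.+1 * gamma_lower m c y.
Proof.
move=> c0; rewrite le_eqVlt => /predU1P[<-|y0].
  by rewrite /gamma_lower mulr0 !set_itv1 !Rintegral_set1 mulr0.
have cy0 : 0 < c * y by rewrite mulr_gt0.
have dF (x : R) := is_derive_gamma_primitive m x.
have cf (b : R) : continuous (fun x : R => x ^+ m * expR (- (b * x))) by exact: continuous_expM.
have cf1 : continuous (fun x : R => x ^+ m * expR (- x)).
  by have := cf 1; under eq_fun do rewrite mul1r.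
have dG (x : R) : is_derive x 1 (fun t => (c ^+ m.+1)^-1 * gamma_primitive m (c * t))
   (x ^+ m * expR (- (c * x))).
  have dc : is_derive x 1 (fun t : R => c * t) c.
    by apply: (is_derive_eq (is_deriveZ c (is_derive_id x (1 : R)))); rewrite /GRing.scale/= mulr1.
  have dGc := @is_derive1_comp R (gamma_primitive m) (fun t : R => c * t) x _ _ (dF (c * x)) dc.
  apply: (is_derive_eq (is_deriveZ (c ^+ m.+1)^-1 dGc)).
  rewrite /GRing.scale/= exprMn exprS; field.
  by rewrite expf_eq0 gt_eqF ?andbF.
rewrite /gamma_lower /Rintegral.
under eq_integral do rewrite mul1r.
rewrite (FTC_is_derive cy0 cf1 dF) (FTC_is_derive y0 (cf c) dG)/= mulr0.
by rewrite -mulrBr mulVKf// expf_eq0 gt_eqF.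
Qed.

Lemma gamma_cdf_lower m z : gamma_cdf m.+1%:R z = (m`!%:R)^-1 * gamma_lower m 1 z.
Proof.
rewrite /gamma_cdf /gamma_lower -RintegralZl//; last exact: integrable_expM.
set F := fun x : R => (m`!%:R)^-1 * (x ^+ m * expR (- (1 * x))).
have iF : mu.-integrable `]0, z] (EFin \o F).
  apply: (@integrableS _ _ _ mu `[0, z]) => //; first exact: subset_itv_oc_cc.
  have -> : EFin \o F = (fun x => (m`!%:R)^-1%:E * (x ^+ m * expR (- (1 * x)))%:E)%E by [].
  by apply: integrableZl => //; exact: integrable_expM.
have e : {in `]0, z]%classic, F =1 gamma_pdf m.+1%:R}.
  move=> x; rewrite inE/= in_itv/= => /andP[x0 _].
  by rewrite gamma_pdfE// /F mul1r mulrC.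
rewrite -Rintegral_itv_obnd_cbnd; last first.
  by apply: eq_integrable iF => // x xz; rewrite /= e.
rewrite -[RHS]Rintegral_itv_obnd_cbnd//.
by apply/esym/eq_Rintegral.
Qed.

(** Write exp (- c' t) = exp (- c t) * exp ((c - c') t) and expand the second
    factor, which on [0, y] is dominated by a convergent series of constants. The
    expansions of the gamma distribution function are choices of [c] and [c']. *)
Lemma cvg_gamma_lower m (c c' y : R) : 0 <= y ->
  series (fun k => (c - c') ^+ k / k`!%:R * gamma_lower (m + k) c y) @ \oo -->
  gamma_lower m c' y.
Proof.
move=> y0.
pose f k (t : R) := (c - c') ^+ k / k`!%:R * (t ^+ (m + k) * expR (- (c * t))).
pose M := y ^+ m * expR (`|c| * y).
have fE k (t : R) : f k t = t ^+ m * expR (- (c * t)) * exp_coeff ((c - c') * t) k.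
  by rewrite /f /exp_coeff/= exprD exprMn; set q := _^-1; ring.
rewrite (_ : (fun k => _) = fun k => \int[mu]_(t in `[0, y]) f k t); last first.
  by apply/funext => k; rewrite /gamma_lower -RintegralZl//; exact: integrable_expM.
apply: (@cvg_series_Rintegral _ _ _ mu `[0, y] f _
    (fun k => M * exp_coeff (`|c - c'| * y) k)) => //.
- have /= -> := @lebesgue_measure_itv R `[0, y].
  by case: ifPn => _; rewrite ?ltry// -EFinD ltry.
- move=> k; apply: measurable_funTS; apply: continuous_measurable_fun.
  by move=> t; apply: cvgM; [exact: cvg_cst|exact: continuous_expM].
- move=> k t /=; rewrite in_itv/= => /andP[t0 ty].
  rewrite fE normrM ler_pM//.
    rewrite normrM !ger0_norm ?exprn_ge0 ?expR_ge0// ler_pM ?exprn_ge0 ?expR_ge0//.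
      by rewrite lerXn2r.
    rewrite ler_expR -mulNr (le_trans (ler_norm _))// normrM normrN.
    by rewrite (ger0_norm t0) ler_wpM2l.
  rewrite /exp_coeff normrM normfV normrX normrM (ger0_norm t0) normr_nat.
  by rewrite ler_wpM2r ?invr_ge0// lerXn2r ?nnegrE ?mulr_ge0// ler_wpM2l.
- have := is_cvg_series_exp_coeff (`|c - c'| * y).
  by move=> h; apply: is_cvg_seriesZ.
- move=> t /=; rewrite in_itv/= => /andP[t0 ty].
  have h := is_cvg_series_exp_coeff ((c - c') * t).
  have -> : t ^+ m * expR (- (c' * t)) = t ^+ m * expR (- (c * t)) * expR ((c - c') * t).
    by rewrite -mulrA -expRD; congr (_ * expR _); ring.
  rewrite (_ : series _ = fun n => t ^+ m * expR (- (c * t)) * series (exp_coeff ((c - c') * t)) n).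
    by apply: cvgM; [exact: cvg_cst|exact: h].
  apply/funext => n; rewrite /series/= mulr_sumr; apply: eq_bigr => k _; exact: fE.
Qed.

End gamma_cdf.

Section gamma_cdf_theory.
Context {R : realType}.
Local Notation mu := (@lebesgue_measure R).

Lemma integral_gamma_cdf m (z : R) :
  (\int[mu]_(t in `[0%R, z]) (gamma_pdf m.+1%:R t)%:E = (gamma_cdf m.+1%:R z)%:E)%E.
Proof.
rewrite /gamma_cdf /Rintegral fineK// ge0_fin_numE.
  apply: (@le_lt_trans _ _ (\int[mu]_t (gamma_pdf m.+1%:R t)%:E)%E).
    apply: ge0_subset_integral => //.
      by apply/measurable_EFinP; exact: measurable_gamma_pdf.
    by move=> t _; rewrite lee_fin gamma_pdf_ge0.
  by rewrite integral_gamma_pdf ltry.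
by apply: integral_ge0 => t _; rewrite lee_fin gamma_pdf_ge0.
Qed.

Lemma gamma_cdf_ge0 m (z : R) : 0 <= gamma_cdf m.+1%:R z.
Proof. by apply: Rintegral_ge0 => t _; exact: gamma_pdf_ge0. Qed.

Lemma gamma_cdf_le1 m (z : R) : gamma_cdf m.+1%:R z <= 1.
Proof.
rewrite -lee_fin -integral_gamma_cdf -(@integral_gamma_pdf R m).
apply: ge0_subset_integral => //.
  by apply/measurable_EFinP; exact: measurable_gamma_pdf.
by move=> t _; rewrite lee_fin gamma_pdf_ge0.
Qed.

(** The closed form through [gamma_primitive], with its argument cut off at 0, is
    continuous. *)
Lemma measurable_gamma_cdf m : measurable_fun setT (gamma_cdf m.+1%:R : R -> R).
Proof.
have dF (x : R) := is_derive_gamma_primitive m x.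
have cF : continuous (gamma_primitive m : R -> R).
  move=> x; apply: differentiable_continuous; apply/derivable1_diffP; exact: ex_derive.
rewrite (_ : gamma_cdf _ = fun z : R => (m`!%:R)^-1 *
   (gamma_primitive m (Order.max 0 z) - gamma_primitive m 0)); last first.
  apply/funext => z; rewrite gamma_cdf_lower; congr (_ * _).
  rewrite /gamma_lower; under eq_Rintegral do rewrite mul1r.
  have [z0|] := ltP 0 z.
    rewrite /Rintegral (@FTC_is_derive _ _ (gamma_primitive m))//.
    by have := @continuous_expM R 1 m; under eq_fun do rewrite mul1r.
  rewrite subrr le_eqVlt => /predU1P[->|z0]; first by rewrite set_itv1 Rintegral_set1.
  by rewrite set_itv_ge ?Rintegral_set0// bnd_simp -ltNge.
apply: measurable_funM => //; apply: measurable_funB => //.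
apply: (@measurableT_comp _ _ _ _ _ _ (gamma_primitive m)).
  exact: continuous_measurable_fun.
exact: measurable_maxr.
Qed.

End gamma_cdf_theory.

(** * Three expansions of the gamma distribution function *)

Section gamma_cdf_series.
Context {R : realType}.
Local Notation mu := (@lebesgue_measure R).

Lemma gamma_cdf_scale m (z y : R) : 0 < z -> 0 <= y ->
  gamma_cdf m.+1%:R (z * y) = z ^+ m.+1 / m`!%:R * gamma_lower m z y.
Proof.
move=> z0 y0; rewrite gamma_cdf_lower gamma_lower_scale//.
by rewrite mulrA [_^-1 * _]mulrC.
Qed.

(** The rates c = 0 and c' = z: the whole exponential is expanded, and powers of [z]
    remain. *)
Lemma cvg_gamma_cdf_powers m (x z : R) : 0 < x -> 0 < z ->
  series (fun k => z ^+ (m.+1 + k) / (m.+1 + k)%:R * ((- x) ^+ k / k`!%:R)) @ \oo -->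
  (x ^+ m.+1 / Gamma m.+1%:R)^-1 * gamma_cdf m.+1%:R (x * z).
Proof.
move=> x0 z0.
have := @cvg_gamma_lower R m 0 z x (ltW x0).
move=> /(cvg_seriesZ (c := z ^+ m.+1 / x ^+ m.+1)).
rewrite [x * z]mulrC gamma_cdf_scale ?ltW// Gamma_nat.
rewrite [X in _ --> X -> _](_ : _ = (x ^+ m.+1 / m`!%:R)^-1 *
  (z ^+ m.+1 / m`!%:R * gamma_lower m z x)); last first.
  have f0 := @fact_neq0 R m; have xm : x ^+ m.+1 != 0 by rewrite expf_neq0// gt_eqF.
  move: (m`!%:R) f0 (x ^+ m.+1) xm => F f0 x' x'0.
  by field; rewrite f0 x'0.
rewrite (_ : (fun k : nat => _ / _ * _) = (fun k =>
  z ^+ (m.+1 + k) / (m.+1 + k)%:R * ((- x) ^+ k / k`!%:R)))//.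
apply/funext => k; rewrite gamma_lower0 ?ltW// sub0r.
rewrite -addSn.
rewrite [(- z) ^+ k]exprNn [(- x) ^+ k]exprNn !exprD.
have xm : x ^+ m.+1 != 0 by rewrite expf_neq0// gt_eqF.
have a0 : (m.+1 + k)%:R != 0 :> R by rewrite pnatr_eq0.
have f0 := @fact_neq0 R k.
move: (k`!%:R) f0 (x ^+ m.+1) xm ((m.+1 + k)%:R) a0 => F f0 x' x'0 a a0.
by field; rewrite f0 x'0 a0.
Qed.

Lemma is_cvg_gamma_powers m (x z : R) : 0 <= x -> 0 <= z ->
  cvgn (series (fun k => z ^+ (m.+1 + k) / (m.+1 + k)%:R * (x ^+ k / k`!%:R))).
Proof.
move=> x0 z0.
apply: (@series_le_cvg _ _ (fun k => z ^+ m.+1 * exp_coeff (x * z) k)).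
- by move=> k; apply: mulr_ge0; rewrite divr_ge0// exprn_ge0.
- move=> k; apply: mulr_ge0; first by rewrite exprn_ge0.
  by apply: exp_coeff_ge0; rewrite mulr_ge0.
- move=> k; rewrite /exp_coeff/= exprD [(x * z) ^+ k]exprMn.
  rewrite [leRHS](_ : _ = z ^+ m.+1 * z ^+ k * (x ^+ k / k`!%:R)); last first.
    by set q := _^-1; ring.
  rewrite ler_wpM2r ?divr_ge0 ?exprn_ge0//.
  by rewrite ler_pdivrMr ?ltr0n// ler_peMr ?mulr_ge0 ?exprn_ge0// ler1n.
- by apply: is_cvg_seriesZ; exact: is_cvg_series_exp_coeff.
Qed.

(** The binomial coefficient trades the normalisation (m + k)! of the distribution
    function of order m + k + 1 for m! k!. *)
Lemma gamma_cdf_binomialE m k (y : R) :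
  'C(m.+1 + k - 1, k)%:R * gamma_cdf (m.+1 + k)%:R y =
  (m`!%:R)^-1 * ((k`!%:R)^-1 * gamma_lower (m + k) 1 y).
Proof.
rewrite addSn subn1/= gamma_cdf_lower.
have := bin_fact (leq_addl m k); rewrite addnK => /(congr1 (fun i : nat => i%:R : R)).
rewrite !natrM => <-.
have f0 := @fact_neq0 R k; have g0 := @fact_neq0 R m.
have c0 : 'C(m + k, k)%:R != 0 :> R by rewrite pnatr_eq0 -lt0n bin_gt0 leq_addl.
move: (k`!%:R) f0 (m`!%:R) g0 ('C(_, _)%:R) c0 => F f0 G g0 C c0.
by field; rewrite f0 g0 c0.
Qed.

(** The rates c = 1 and c' = Z: what remains are gamma distribution functions of
    higher order at the fixed point [y]. *)
Lemma cvg_gamma_cdf_binomial m (y Z : R) : 0 < y -> 0 < Z ->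
  series (fun k => Z ^+ m.+1 * (1 - Z) ^+ k *
    ('C(m.+1 + k - 1, k)%:R * gamma_cdf (m.+1 + k)%:R y)) @ \oo -->
  gamma_cdf m.+1%:R (Z * y).
Proof.
move=> y0 Z0; have := @cvg_gamma_lower R m 1 Z y (ltW y0).
move=> /(cvg_seriesZ (c := Z ^+ m.+1 / m`!%:R)); rewrite -gamma_cdf_scale ?ltW//.
rewrite (_ : (fun k : nat => _ / _ * _) = (fun k => Z ^+ m.+1 * (1 - Z) ^+ k *
    ('C(m.+1 + k - 1, k)%:R * gamma_cdf (m.+1 + k)%:R y)))//.
by apply/funext => k; rewrite gamma_cdf_binomialE; ring.
Qed.

(** For j > 0 both sides are (b - 1) ... (b - j + 1) / j!. This is the passage from
    the negative binomial series to the coefficients of [Ppoly]. *)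
Lemma rising_binomE (b : R) j : b != 0 -> b - j%:R != 0 ->
  rising_binom (b - j%:R) j / (b - j%:R) = gbinom b j / b.
Proof.
move=> b0 bj0.
suff h : b * \prod_(i < j) (b - j%:R + i%:R) = (b - j%:R) * \prod_(i < j) (b - i%:R).
  rewrite /rising_binom /gbinom.
  set F := j`!%:R^-1; move: h; set A := \prod_(_ < _) _; set B := \prod_(_ < _) _ => h.
  apply: (@mulfI _ b) => //; apply: (@mulfI _ (b - j%:R)) => //.
  rewrite [LHS](_ : _ = b * A * F); last by field.
  by rewrite h; field.
rewrite [RHS]mulrC; have <- := @big_ord_recr _ _ _ j (fun i : 'I_j.+1 => b - i%:R).
rewrite big_ord_recl/= subr0; congr (_ * _).
rewrite (reindex_inj rev_ord_inj)/=; apply: eq_bigr => i _.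
rewrite /bump/= add1n natrB; last exact: ltn_ord.
by rewrite addrA subrK.
Qed.

(** Up to the sign (-1) ^ k, the term of index [k] of the expansion in powers of the
    cosine [s]. *)
Definition angle_term (m : nat) (x s : R) k :=
  s ^+ (m.+1 + k) * ((m.+1 + k)%:R^-1 * (Ppoly m.+1 k).[x]).

(** Expanding (1 - s ^ 2) ^ (- (m + 1 + k) / 2) in each term of
    [cvg_gamma_cdf_powers] gives a double series in [k] and [j]; the terms with the
    same power of [s], that is with the same k + 2 j, make up one polynomial. *)
Lemma PpolyE m k (x s : R) :
  angle_term m x s k =
  \sum_(j < (k %/ 2).+1) (x ^+ (k - 2 * j) / ((k - 2 * j)`!%:R * (m.+1 + (k - 2 * j))%:R) *
   (rising_binom ((m.+1 + (k - 2 * j))%:R / 2) j * (s ^+ 2) ^+ j) * s ^+ (m.+1 + (k - 2 * j))).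
Proof.
rewrite /angle_term /Ppoly horner_sum divn2 !mulr_sumr; apply: eq_bigr => j _.
have jk : (2 * j <= k)%N by move: (ltn_ord j); rewrite ltnS mul2n geq_half_double.
rewrite hornerZ hornerXn -mul2n.
have e1 : (m.+1 + k)%:R / 2 = (m.+1 + (k - 2 * j))%:R / 2 + j%:R :> R.
  by rewrite -{1}(subnK jk) addnA natrD natrM; field.
have b0 : (m.+1 + (k - 2 * j))%:R != 0 :> R by rewrite pnatr_eq0.
have a0 : (m.+1 + k)%:R != 0 :> R by rewrite pnatr_eq0.
have H := @rising_binomE ((m.+1 + k)%:R / 2) j; rewrite e1 addrK in H.
have {H} : rising_binom ((m.+1 + (k - 2 * j))%:R / 2) j / ((m.+1 + (k - 2 * j))%:R / 2)
   = gbinom ((m.+1 + k)%:R / 2) j / ((m.+1 + k)%:R / 2) :> R.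
  by rewrite e1; apply: H; rewrite -?e1 mulf_neq0.
have -> : s ^+ (m.+1 + k) = (s ^+ 2) ^+ j * s ^+ (m.+1 + (k - 2 * j)).
  by rewrite -exprM -exprD; congr (_ ^+ _); lia.
have f0 := @fact_neq0 R (k - 2 * j).
move: (rising_binom _ _) (gbinom _ _) => r g.
move: ((k - 2 * j)`!%:R) f0 ((m.+1 + (k - 2 * j))%:R) b0 ((m.+1 + k)%:R) a0 => F f0 B b0 A a0 h.
have -> : g = A * (r / B).
  move: h => /(congr1 (fun z => z * (A / 2))); rewrite divfK ?mulf_neq0// => <-.
  by field.
by field; rewrite f0 b0 a0.
Qed.

Section angle_series.
Variables (m : nat) (x s : R).
Hypotheses (x0 : 0 < x) (s0 : 0 < s) (s1 : s < 1).
Let z := s / Num.sqrt (1 - s ^+ 2).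
Let t k j := x ^+ k / (k`!%:R * (m.+1 + k)%:R) *
   (rising_binom ((m.+1 + k)%:R / 2) j * (s ^+ 2) ^+ j) * s ^+ (m.+1 + k).
Let tau k := z ^+ (m.+1 + k) / (m.+1 + k)%:R * (x ^+ k / k`!%:R).

Let t0 k j : 0 <= t k j.
Proof.
have xk : 0 <= x ^+ k by rewrite exprn_ge0 ?ltW.
have sk : 0 <= s ^+ (m.+1 + k) by rewrite exprn_ge0 ?ltW.
apply: mulr_ge0 sk; apply: mulr_ge0; first by rewrite divr_ge0// mulr_ge0.
apply: mulr_ge0; first by apply: rising_binom_ge0; rewrite divr_ge0.
by rewrite exprn_ge0// sqr_ge0.
Qed.

Let s2 : 0 < 1 - s ^+ 2.
Proof. by rewrite subr_gt0 expr_lt1// ltW. Qed.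

Let z0 : 0 < z.
Proof. by rewrite divr_gt0// sqrtr_gt0. Qed.

Let cvg_t k : series (t k) @ \oo --> tau k.
Proof.
have := @cvg_negative_binomial R (s ^+ 2) (m.+1 + k) (sqr_ge0 s) _.
rewrite -subr_gt0 => /(_ s2)/(cvg_seriesZ
   (c := x ^+ k / (k`!%:R * (m.+1 + k)%:R) * s ^+ (m.+1 + k))).
rewrite (_ : (fun j : nat => _ * s ^+ _ * _) = t k); last first.
  by apply/funext => j; rewrite /t; ring.
rewrite [X in _ --> X](_ : _ = tau k)// /tau /z exprMn.
have f0 := @fact_neq0 R k; have a0 : (m.+1 + k)%:R != 0 :> R by rewrite pnatr_eq0.
move: (k`!%:R) f0 ((m.+1 + k)%:R) a0 => F f0 A a0.
by move: (_ ^-1 ^+ _) => q; field; rewrite f0 a0.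
Qed.

Let cvg_tau : cvgn (series tau).
Proof. by apply: is_cvg_gamma_powers; exact: ltW. Qed.

(** For z = s / sqrt (1 - s ^ 2), [cvg_gamma_cdf_powers] becomes the double series of
    [PpolyE], which [cvg_antidiag] regroups along k + 2 j. *)
Lemma cvg_gamma_cdf_angle :
  series (fun k => (-1) ^+ k * angle_term m x s k) @ \oo -->
  (x ^+ m.+1 / Gamma m.+1%:R)^-1 * gamma_cdf m.+1%:R (x * z).
Proof.
have H := @cvg_gamma_cdf_powers m x z x0 z0.
have := @cvg_antidiag R t tau (fun k => (-1) ^+ k) 2 _ (ltn0Sn _) _ _ t0 cvg_t cvg_tau.
rewrite (_ : (fun k : nat => (-1) ^+ k * tau k) = (fun k =>
   z ^+ (m.+1 + k) / (m.+1 + k)%:R * ((- x) ^+ k / k`!%:R))); last first.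
  by apply/funext => k; rewrite /tau [(- x) ^+ k]exprNn; set p := _^-1; set q := _`!%:R^-1; ring.
move=> /(_ _ _ _ H).
rewrite (_ : (fun k : nat => _ * \sum_(_ < _) _) =
  (fun k => (-1) ^+ k * angle_term m x s k)).
  apply.
  - by move=> k j; rewrite exprD exprM sqrrN expr1n expr1n mulr1.
  - by move=> k; rewrite normrX normrN normr1 expr1n.
by apply/funext => k; rewrite PpolyE.
Qed.

Lemma angle_term_ge0 k : 0 <= angle_term m x s k.
Proof. by rewrite PpolyE; apply: sumr_ge0 => j _; exact: t0. Qed.

(** The same regrouping without signs. As the terms increase with [s], this series
    is the one that dominates the expansion for all smaller cosines. *)
Lemma is_cvg_angle_term : cvgn (series (angle_term m x s)).
Proof.
have h : series (fun k => 1 * tau k) @ \oo --> limn (series tau).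
  by under eq_fun do rewrite mul1r; exact: cvg_tau.
have := @cvg_antidiag R t tau (fun=> 1) 2 _ (ltn0Sn _) _ _ t0 cvg_t cvg_tau h.
rewrite (_ : (fun k : nat => 1 * \sum_(_ < _) _) = angle_term m x s).
  move=> H; apply: (cvgP _ (H _ _)) => // k; by rewrite normr1.
by apply/funext => k; rewrite PpolyE mul1r.
Qed.

End angle_series.

End gamma_cdf_series.

(** * One more gamma variable: sum and quotient of squares *)

Section independence.
Context d (T : measurableType d) (R : realType) (P : probability T R).

(** Rectangles determine a product measure. The event [E] carries the condition on
    the variables that are still to come in the induction. *)
Lemma product_law d1 d2 (T1 : measurableType d1) (T2 : measurableType d2)
    (E : set T) (f : T -> T1) (g : T -> T2)
    (m1 : {finite_measure set T1 -> \bar R})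
    (m2 : {finite_measure set T2 -> \bar R}) (D : set (T1 * T2)) :
  measurable E -> measurable_fun setT f -> measurable_fun setT g ->
  (forall A B, measurable A -> measurable B ->
    P (f @^-1` A `&` g @^-1` B `&` E) = P E * (m1 A * m2 B))%E ->
  measurable D ->
  (P ((fun w => (f w, g w)) @^-1` D `&` E) = P E * (m1 \x m2) D)%E.
Proof.
move=> mE mf mg fgE mD.
have PE : P E = (fine (P E))%:E by rewrite fineK// fin_num_measure.
have p0 : 0 <= fine (P E) by rewrite fine_ge0.
pose m1' : {finite_measure set T1 -> \bar R} := mscale (NngNum p0) m1.
pose fg w := (f w, g w).
have mfg : measurable_fun setT fg by exact: measurable_fun_pair.
have H : forall X : set (T1 * T2), measurable X ->
    (m1' \x m2)%E X = pushforward (mrestr P mE) fg X.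
  apply: product_measure_unique => A B mA mB.
  have m1E : m1' A = (P E * m1 A)%E by rewrite PE.
  by rewrite /= /pushforward/= /mrestr fgE// m1E muleA.
apply: etrans (esym (H _ mD)) _.
have mx := measurable_fun_xsection m2 mD.
have := @ge0_integral_mscale _ _ R m1 setT measurableT (NngNum p0) (m2 \o xsection D) mx.
move=> /(_ (fun x _ => measure_ge0 m2 _)) H2; apply: etrans H2 _.
by congr (_ * _)%E; exact/esym/PE.
Qed.

End independence.

Section gamma_split.
Context {R : realType}.
Local Notation mu := (@lebesgue_measure R).
Local Notation GR := (measurableTypeR R).

(** The beta density of X / (Y + X), for independent gamma variables Y and X of
    orders p + 1 and q + 1. *)
Definition ratio_density (p q : nat) (u : R) : R :=
  (if (0 < u) && (u < 1) then (1 - u) ^+ p * u ^+ q else 0) *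
  ((p + q).+1`!%:R / (p`!%:R * q`!%:R)).

Lemma measurable_ratio_density p q : measurable_fun setT (ratio_density p q).
Proof.
apply: measurable_funM => //; apply: measurable_fun_ifT => //.
  by apply: measurable_and; exact: measurable_fun_ltr.
by apply: measurable_funM; apply: measurable_funX => //; exact: measurable_funB.
Qed.

Lemma ratio_density_ge0 p q u : 0 <= ratio_density p q u.
Proof.
rewrite mulr_ge0 ?divr_ge0//; case: ifPn => // /andP[u0 u1].
by rewrite mulr_ge0// exprn_ge0// ?subr_ge0 ltW.
Qed.

(** The factor [s] on the left is the Jacobian of (s, u) |-> (s - s u, s u). *)
Lemma gamma_pdf_split p q (s u : R) : 0 < s ->
  s * (gamma_pdf p.+1%:R (s - s * u) * gamma_pdf q.+1%:R (s * u)) =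
  gamma_pdf (p + q).+2%:R s * ratio_density p q u.
Proof.
move=> s0; rewrite /ratio_density.
have -> : s - s * u = s * (1 - u) by rewrite mulrBr mulr1.
have [u0|u0] := leP u 0.
  by rewrite [gamma_pdf q.+1%:R _]gamma_pdf_le0 ?mulr0 ?mul0r ?mulr0// mulr_ge0_le0// ltW.
have [u1|u1] := leP 1 u.
  by rewrite gamma_pdf_le0 ?mul0r ?mulr0// mulr_ge0_le0 ?subr_le0// ltW.
rewrite !gamma_pdfE ?mulr_gt0 ?subr_gt0// !exprMn.
have -> : expR (- s) = expR (- (s * (1 - u))) * expR (- (s * u)).
  by rewrite -expRD; congr expR; ring.
rewrite (_ : s ^+ (p + q).+1 = s * s ^+ p * s ^+ q); last by rewrite exprS exprD mulrA.
rewrite /=.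
have f0 k : k`!%:R != 0 :> R by rewrite pnatr_eq0 -lt0n fact_gt0.
have := f0 p; have := f0 q; have := f0 (p + q).+1.
move: (_`!%:R) (_`!%:R) (_`!%:R) => x y z x0 y0 z0.
by field; rewrite x0 y0 z0.
Qed.

Lemma tonelli_lebesgue (F : R -> R -> R) : (forall y x, 0 <= F y x) ->
  measurable_fun setT (fun z : GR * GR => F z.1 z.2) ->
  (\int[mu]_y \int[mu]_x (F y x)%:E = \int[mu]_x \int[mu]_y (F y x)%:E)%E.
Proof.
move=> F0 mF.
apply: (@fubini_tonelli _ _ _ _ R mu mu (fun z : GR * GR => (F z.1 z.2)%:E)).
  exact/measurable_EFinP.
by move=> z; rewrite lee_fin.
Qed.

(** The map (y, x) |-> (y + x, x) has Jacobian 1. *)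
Lemma tonelli_shear (F : R -> R -> R) : (forall s x, 0 <= F s x) ->
  measurable_fun setT (fun z : GR * GR => F z.1 z.2) ->
  (\int[mu]_y \int[mu]_x (F (y + x)%R x)%:E = \int[mu]_s \int[mu]_x (F s x)%:E)%E.
Proof.
move=> F0 mF.
have mF' : measurable_fun setT (fun z : GR * GR => F (z.1 + z.2) z.2).
  apply: (measurableT_comp mF (g := fun z : GR * GR => (z.1 + z.2 : GR, z.2))).
  apply: measurable_fun_pair => //.
  by apply: measurable_funD; [exact: measurable_fst|exact: measurable_snd].
rewrite (tonelli_lebesgue (F := fun y x => F (y + x) x))// (tonelli_lebesgue F0 mF).
apply: eq_integral => x _.
have mFx : measurable_fun setT (fun s : GR => F s x).
  by apply: (measurableT_comp mF (g := fun s : GR => (s, x : GR))).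
have := @ge0_integral_affine R 1 x (fun s => (F s x)%:E) ltr01.
rewrite invr1 mul1e => <-//.
- by apply: eq_integral => y _; rewrite mul1r.
- exact/measurable_EFinP.
- by move=> s; rewrite lee_fin.
Qed.

(** The substitution x = s u in the inner integral; it is a change of variables only
    for s > 0, outside of which [F] vanishes. *)
Lemma tonelli_polar (F : R -> R -> R) : (forall s x, 0 <= F s x) ->
  (forall s x, s <= 0 -> F s x = 0) ->
  measurable_fun setT (fun z : GR * GR => F z.1 z.2) ->
  (\int[mu]_s \int[mu]_x (F s x)%:E = \int[mu]_s \int[mu]_u (s * F s (s * u))%:E)%E.
Proof.
move=> F0 Fneg mF; apply: eq_integral => s _.
have [s0|s0] := leP s 0.
  rewrite !integral0_eq// => x _; rewrite Fneg// mulr0//.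
have mFs : measurable_fun setT (fun x : GR => F s x).
  apply: (measurableT_comp mF (g := fun x : GR => (s : GR, x))).
  by apply: measurable_fun_pair => //; exact: measurable_cst.
have := @ge0_integral_affine R s 0 (fun x => (F s x)%:E) s0.
move=> /(_ _ _)/(congr1 (fun z => s%:E * z))%E.
rewrite muleA -EFinM divff ?gt_eqF// mul1e => <-.
- rewrite -ge0_integralZl//.
  + by apply: eq_integral => u _; rewrite -EFinM addr0.
  + apply/measurable_EFinP; apply: (measurableT_comp mFs).
    exact: measurable_affine.
  + by move=> u _; rewrite lee_fin.
  + by rewrite lee_fin ltW.
- exact/measurable_EFinP.
- by move=> x; rewrite lee_fin.
Qed.

(** In the coordinates s = y + x and u = x / s, reached by [tonelli_shear] and
    [tonelli_polar], the joint density factorises by [gamma_pdf_split]; so sum and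
    ratio are independent. *)
Lemma gamma_sum_ratio (m1 m2 : {finite_measure set GR -> \bar R}) p q (A C : set R) :
  (forall B, measurable B -> m1 B = \int[mu]_(x in B) (gamma_pdf p.+1%:R x)%:E)%E ->
  (forall B, measurable B -> m2 B = \int[mu]_(x in B) (gamma_pdf q.+1%:R x)%:E)%E ->
  measurable A -> measurable C ->
  ((m1 \x m2) [set z : GR * GR | A (z.1 + z.2)%R /\ C (z.2 / (z.1 + z.2))%R] =
   (\int[mu]_(x in A) (gamma_pdf (p + q).+2%:R x)%:E) *
   (\int[mu]_(u in C) (ratio_density p q u)%:E))%E.
Proof.
move=> m1E m2E mA mC; set D := [set _ | _].
have mfst : measurable_fun setT (fun z : GR * GR => z.1 : R) by exact: measurable_fst.
have msnd : measurable_fun setT (fun z : GR * GR => z.2 : R) by exact: measurable_snd.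
have msum : measurable_fun setT (fun z : GR * GR => (z.1 + z.2) : R).
  exact: measurable_funD.
have mD : measurable D.
  have mrat : measurable_fun setT (fun z : GR * GR => z.2 / (z.1 + z.2) : R).
    apply: measurable_funM => //.
    exact: (measurableT_comp measurable_inv msum).
  rewrite (_ : D = (fun z => z.1 + z.2) @^-1` A `&` (fun z => z.2 / (z.1 + z.2)) @^-1` C)//.
  apply: measurableI; rewrite -[X in measurable X]setTI.
    exact: msum.
  exact: mrat.
have mIA : measurable_fun setT (\1_A : R -> R) by exact: measurable_indic.
have mIC : measurable_fun setT (\1_C : R -> R) by exact: measurable_indic.
pose F (s x : R) : R := \1_A s * \1_C (x / s) *
   (gamma_pdf p.+1%:R (s - x) * gamma_pdf q.+1%:R x).
have F0 s x : 0 <= F s x by rewrite !mulr_ge0 ?gamma_pdf_ge0.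
have Fneg s x : s <= 0 -> F s x = 0.
  move=> s0; rewrite /F.
  have [x0|x0] := leP x 0; first by rewrite [gamma_pdf q.+1%:R _]gamma_pdf_le0// !mulr0.
  by rewrite gamma_pdf_le0 ?mul0r ?mulr0// subr_le0 (le_trans s0)// ltW.
have mF : measurable_fun setT (fun z : GR * GR => F z.1 z.2).
  apply: measurable_funM; apply: measurable_funM.
  - exact: (measurableT_comp mIA mfst).
  - apply: (measurableT_comp mIC).
    apply: measurable_funM => //.
    exact: (measurableT_comp measurable_inv mfst).
  - apply: (measurableT_comp (measurable_gamma_pdf p)).
    exact: measurable_funB.
  - exact: (measurableT_comp (measurable_gamma_pdf q) msnd).
have -> : ((m1 \x m2) D = \int[mu]_y \int[mu]_x (F (y + x)%R x)%:E)%E.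
  rewrite /product_measure1.
  rewrite (ge0_integral_density (measurable_gamma_pdf p) (gamma_pdf_ge0 p) m1E)//; last first.
    exact: measurable_fun_xsection.
  apply: eq_integral => y _.
  rewrite /= m2E; last exact: measurable_xsection.
  rewrite -ge0_integralZr//.
  - rewrite integral_mkcond; apply: eq_integral => x _.
    rewrite patchE /F -EFinM !indicE; case: ifPn; rewrite mem_xsection.
      rewrite inE /D/= => -[h1 h2].
      by rewrite !mem_set// !mul1r addrK mulrC.
    rewrite notin_setE /D/= => h.
    have [yxA|yxA] := boolP (y + x \in A); last by rewrite !mul0r.
    have [yxC|yxC] := boolP (x / (y + x) \in C); last by rewrite mulr0 !mul0r.
    by case: h; split; exact: set_mem.
  - by apply: measurable_xsection.
  - by apply/measurable_EFinP; apply: measurable_funTS; exact: measurable_gamma_pdf.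
  - by move=> x _; rewrite lee_fin gamma_pdf_ge0.
  - by rewrite lee_fin gamma_pdf_ge0.
rewrite (tonelli_shear F0 mF) (tonelli_polar F0 Fneg mF).
have mrd := measurable_ratio_density p q.
have mgd := measurable_gamma_pdf (R := R) (p + q).+1.
have mCr : measurable_fun setT (fun u : GR => (\1_C u * ratio_density p q u)%:E).
  by apply/measurable_EFinP; apply: measurable_funM => //; exact: measurable_indic.
transitivity (\int[mu]_s ((\1_A s * gamma_pdf (p + q).+2%:R s)%:E *
    \int[mu]_u (\1_C u * ratio_density p q u)%:E))%E.
  apply: eq_integral => s _.
  rewrite -ge0_integralZl//; last 2 first.
    by move=> u _; rewrite lee_fin mulr_ge0// ratio_density_ge0.
    by rewrite lee_fin mulr_ge0// gamma_pdf_ge0.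
  apply: eq_integral => u _; rewrite -EFinM; congr EFin.
  have [s0|s0] := leP s 0; first by rewrite Fneg// gamma_pdf_le0// !(mulr0, mul0r).
  rewrite /F [RHS]mulrACA -(gamma_pdf_split _ _ _ s0).
  rewrite [s * u / s](_ : _ = u); last by rewrite mulrAC divff ?mul1r ?gt_eqF.
  ring.
rewrite ge0_integralZr//; last 3 first.
- by apply/measurable_EFinP; apply: measurable_funM => //; exact: measurable_indic.
- by move=> s _; rewrite lee_fin mulr_ge0// gamma_pdf_ge0.
- by apply: integral_ge0 => u _; rewrite lee_fin mulr_ge0// ratio_density_ge0.
by congr (_ * _)%E; rewrite [RHS]integral_mkcond; apply: eq_integral => u _;
  rewrite patchE indicE; case: ifPn; rewrite ?mul1r ?mul0r.
Qed.

End gamma_split.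

Section gamma_step.
Context d (T : measurableType d) (R : realType) (P : probability T R).
Local Notation mu := (@lebesgue_measure R).
Local Notation GR := (measurableTypeR R).

(** Completing the square writes the polynomial as an affine function of the square
    of an affine function of [u], and each of the three maps pulls null sets back to
    null sets. *)
Lemma null_quadratic (v : R) (N : set R) : 0 <= v -> measurable N -> mu N = 0%E ->
  mu [set u | N ((1 - u) ^+ 2 * v + u ^+ 2)] = 0%E.
Proof.
move=> v0 mN N0; pose c := 1 + v; have c0 : 0 < c by rewrite ltr_wpDr.
pose e := v - v ^+ 2 / c.
have mN1 : measurable ((fun w => c * w + e) @^-1` N).
  by rewrite -[X in measurable X]setTI; exact: measurable_affine.
have N1 := null_affine e c0 mN N0.
have mN2 : measurable ((fun u : R => u ^+ 2) @^-1` ((fun w => c * w + e) @^-1` N)).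
  by rewrite -[X in measurable X]setTI; exact: (exprn_measurable 2).
have N2 := null_preimage_sqr mN1 N1.
rewrite -[RHS](null_affine (- (v / c)) ltr01 mN2 N2); congr (mu _).
apply/seteqP; split => u /=; rewrite /e;
  (have -> : (1 - u) ^+ 2 * v + u ^+ 2 =
     c * (1 * u + - (v / c)) ^+ 2 + (v - v ^+ 2 / c)) => //;
  by rewrite /c; field; rewrite gt_eqF.
Qed.

(** Gives [Z] the codomain on which Lebesgue measure lives, so that the law of [Z] and
    Lebesgue measure are measures on the same space. *)
Definition law (Z : T -> R) (mZ : measurable_fun setT Z) : {mfun T >-> GR} :=
  HB.pack Z (isMeasurableFun.Build _ _ T GR Z mZ).

(** [Y] and [V] are the sum and the quotient (sum of squares) / (sum) ^ 2 of some
    gamma variables, [X] is one more, and [F] contains events that concern others.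
    The ratio U = X / Y' is independent of [Y'], [V] and [F], and [V'] is a function
    of U and V; hence [V'] is independent of [Y'] and [F]. For a fixed value of [V] it
    is a quadratic polynomial in U, which has a density, so null sets get no mass. *)
Lemma gamma_step (Y V X : T -> R) (F : set (set T)) (p q : nat) :
  measurable_fun setT Y -> measurable_fun setT V -> measurable_fun setT X ->
  (forall E, F E -> measurable E) -> F setT ->
  (forall B, measurable B ->
    P (Y @^-1` B) = \int[mu]_(x in B) (gamma_pdf p.+1%:R x)%:E)%E ->
  (forall B, measurable B ->
    P (X @^-1` B) = \int[mu]_(x in B) (gamma_pdf q.+1%:R x)%:E)%E ->
  (forall E A B C, F E -> measurable A -> measurable B -> measurable C ->
    P (Y @^-1` A `&` V @^-1` B `&` X @^-1` C `&` E) =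
    P E * (P (Y @^-1` A) * P (V @^-1` B) * P (X @^-1` C)))%E ->
  let Y' w := Y w + X w in
  let V' w := (1 - X w / Y' w) ^+ 2 * V w + (X w / Y' w) ^+ 2 in
  [/\ forall B, measurable B ->
       (P (Y' @^-1` B) = \int[mu]_(x in B) (gamma_pdf (p + q).+2%:R x)%:E)%E,
     forall E A B, F E -> measurable A -> measurable B ->
       (P (Y' @^-1` A `&` V' @^-1` B `&` E) =
        P E * (P (Y' @^-1` A) * P (V' @^-1` B)))%E &
     (forall w, 0 <= V w) -> forall N, measurable N -> mu N = 0%E ->
       P (V' @^-1` N) = 0%E].
Proof.
move=> mY mV mX mF FT Yd Xd ind Y' V'.
have mpre (Z : T -> R) (B : set R) : measurable_fun setT Z -> measurable B ->
    measurable (Z @^-1` B).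
  by move=> mZ mB; rewrite -[X in measurable X]setTI; exact: mZ.
have mY' : measurable_fun setT Y' by exact: measurable_funD.
pose U w := X w / Y' w.
have mU : measurable_fun setT U.
  by apply: measurable_funM => //; exact: (measurableT_comp measurable_inv mY').
have mfst : measurable_fun setT (fun z : GR * GR => z.1 : R) by exact: measurable_fst.
have msnd : measurable_fun setT (fun z : GR * GR => z.2 : R) by exact: measurable_snd.
have PT : P setT = 1%E := probability_setT P.
have indVE E B : F E -> measurable B -> (P (V @^-1` B `&` E) = P E * P (V @^-1` B))%E.
  move=> FE mB; have := ind E setT B setT FE measurableT mB measurableT.
  by rewrite !preimage_setT setTI setIT PT mul1e mule1.
pose beta C := (\int[mu]_(u in C) (ratio_density p q u)%:E)%E.
pose gam A := (\int[mu]_(x in A) (gamma_pdf (p + q).+2%:R x)%:E)%E.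
(* Joint independence of Y', U, V and the events in F, from [gamma_sum_ratio] on
   the event that V is in B and E happens. *)
have key E A B C : F E -> measurable A -> measurable B -> measurable C ->
  (P (Y' @^-1` A `&` U @^-1` C `&` (V @^-1` B `&` E)) =
   P E * P (V @^-1` B) * (gam A * beta C))%E.
  move=> FE mA mB mC.
  have mVE : measurable (V @^-1` B `&` E) by apply: measurableI; [exact: mpre|exact: mF].
  have mD : measurable [set z : GR * GR | A (z.1 + z.2) /\ C (z.2 / (z.1 + z.2))].
    have msum : measurable_fun setT (fun z : GR * GR => (z.1 + z.2) : R).
      exact: measurable_funD.
    have mrat : measurable_fun setT (fun z : GR * GR => z.2 / (z.1 + z.2) : R).
      apply: measurable_funM => //.
      exact: (measurableT_comp measurable_inv msum).
    rewrite [X in measurable X](_ : _ =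
      (fun z => z.1 + z.2) @^-1` A `&` (fun z => z.2 / (z.1 + z.2)) @^-1` C)//.
    apply: measurableI; rewrite -[X in measurable X]setTI.
      exact: msum.
    exact: mrat.
  have := @product_law _ _ _ P _ _ GR GR _ _ _ (distribution P (law mY))
    (distribution P (law mX)) _ mVE mY mX _ mD.
  have GS := @gamma_sum_ratio R (distribution P (law mY)) (distribution P (law mX))
    p q A C Yd Xd mA mC.
  rewrite GS indVE// => H; apply: H => A' B' mA' mB'.
  rewrite -muleA; apply: etrans (_ : P (Y @^-1` A' `&` V @^-1` B `&` X @^-1` B' `&` E) = _)%E.
    congr (P _).
    by rewrite -!setIA; congr (_ `&` _); rewrite setICA.
  rewrite (ind _ _ _ _ FE mA' mB mB'); congr (_ * _)%E.
  by rewrite -muleA muleCA.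
have betaT : beta setT = 1%E.
  have := key setT setT setT setT FT measurableT measurableT measurableT.
  by rewrite !preimage_setT !setIT PT /gam integral_gamma_pdf !mul1e.
have PY' A : measurable A -> P (Y' @^-1` A) = gam A.
  move=> mA; have := key setT A setT setT FT mA measurableT measurableT.
  by rewrite !preimage_setT !setIT PT !mul1e betaT mule1.
have PU C : measurable C -> P (U @^-1` C) = beta C.
  move=> mC; have := key setT setT setT C FT measurableT measurableT mC.
  by rewrite !preimage_setT !setIT setTI PT !mul1e /gam integral_gamma_pdf mul1e.
(* V' is a function of V and U, so its law, given that Y' is in A and E happens,
   comes from their product law. *)
have key2 E A B : F E -> measurable A -> measurable B ->
  (P (V' @^-1` B `&` (Y' @^-1` A `&` E)) =
   P E * P (Y' @^-1` A) *
   (distribution P (law mV) \x distribution P (law mU))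
     [set z : GR * GR | B ((1 - z.2) ^+ 2 * z.1 + z.2 ^+ 2)%R])%E.
  move=> FE mA mB.
  have mE : measurable (Y' @^-1` A `&` E) by apply: measurableI; [exact: mpre|exact: mF].
  have mD : measurable [set z : GR * GR | B ((1 - z.2) ^+ 2 * z.1 + z.2 ^+ 2)].
    have mh : measurable_fun setT (fun z : GR * GR => (1 - z.2) ^+ 2 * z.1 + z.2 ^+ 2 : R).
      apply: measurable_funD; last exact: measurable_funX.
      apply: measurable_funM => //; apply: measurable_funX.
      exact: measurable_funB.
    by rewrite -[X in measurable X]setTI; exact: mh.
  have PE : (P (Y' @^-1` A `&` E) = P E * P (Y' @^-1` A))%E.
    have := key E A setT setT FE mA measurableT measurableT.
    by rewrite !preimage_setT setIT setTI PT mule1 betaT mule1 PY'.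
  have := @product_law _ _ _ P _ _ GR GR _ _ _ (distribution P (law mV))
    (distribution P (law mU)) _ mE mV mU _ mD.
  rewrite PE => H; apply: H => B' C' mB' mC'.
  have -> : V @^-1` B' `&` U @^-1` C' `&` (Y' @^-1` A `&` E) =
      Y' @^-1` A `&` U @^-1` C' `&` (V @^-1` B' `&` E).
    by rewrite !setIA; congr (_ `&` _); rewrite setIC setIA [RHS]setIAC.
  rewrite key// PY'// -!muleA; congr (_ * _)%E; rewrite [RHS]muleCA; congr (_ * _)%E.
  by rewrite -PU.
have PV' B : measurable B -> (P (V' @^-1` B) =
   (distribution P (law mV) \x distribution P (law mU))
     [set z : GR * GR | B ((1 - z.2) ^+ 2 * z.1 + z.2 ^+ 2)%R])%E.
  move=> mB; have := key2 setT setT B FT measurableT mB.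
  by rewrite !preimage_setT !setIT PT !mul1e.
split => //.
- move=> E A B FE mA mB.
  by rewrite [Y' @^-1` A `&` _]setIC -setIA key2// PV'// muleA.
- move=> V0 N mN N0; rewrite PV'// /product_measure1.
  set D := [set z | _].
  have mD : measurable D.
    have mh : measurable_fun setT (fun z : GR * GR => (1 - z.2) ^+ 2 * z.1 + z.2 ^+ 2 : R).
      apply: measurable_funD; last exact: measurable_funX.
      apply: measurable_funM => //; apply: measurable_funX.
      exact: measurable_funB.
    by rewrite -[X in measurable X]setTI; exact: mh.
  have mx := measurable_fun_xsection (distribution P (law mU)) mD.
  rewrite (ge0_integral_distribution _ mx); last by move=> y; exact: measure_ge0.
  rewrite integral0_eq// => w _ /=.
  have mxs : measurable (xsection D (V w)) by exact: measurable_xsection.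
  apply: etrans (PU _ mxs) _.
  have xs0 : mu (xsection D (V w)) = 0%E.
    rewrite -[RHS](null_quadratic (V0 w) mN N0); congr (mu _).
    by apply/seteqP; split => u; rewrite /= xsectionE.
  apply: null_set_integral => //.
  by apply/measurable_EFinP; apply: measurable_funTS; exact: measurable_ratio_density.
Qed.

End gamma_step.

(** * Geometry of the sample *)

Section sample_geometry.
Context d (T : measurableType d) (R : realType) (P : probability T R).
Context (n : nat) (X : 'I_n -> {RV P >-> R}).
Hypothesis n_ge2 : (2 <= n)%N.

Let Y w := \sum_(i < n) X i w.
Let Q w := \sum_(i < n) X i w ^+ 2.

Definition cosPhi w : R := Y w / (Num.sqrt n%:R * Num.sqrt (Q w)).

Let n0 : 0 < n%:R :> R.
Proof. by rewrite ltr0n (leq_trans _ n_ge2). Qed.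

Let n1 : 0 < n%:R - 1 :> R.
Proof. by rewrite subr_gt0 ltr1n. Qed.

Lemma sum_sqr_deviation w :
  \sum_(i < n) (X i w - sample_mean X w) ^+ 2 = Q w - Y w ^+ 2 / n%:R.
Proof.
rewrite /sample_mean -/(Y w); set m := _^-1 * _.
transitivity (\sum_(i < n) (X i w ^+ 2 + (- (m *+ 2) * X i w + m ^+ 2))).
  by apply: eq_bigr => i _; rewrite mulr2n; ring.
rewrite !big_split/= -mulr_sumr sumr_const card_ord -/(Q w) -/(Y w).
by rewrite /m -mulr_natl; field; rewrite gt_eqF.
Qed.

(** Cauchy-Schwarz: the sum of the squared deviations is nonnegative. *)
Lemma sqr_sum_le w : Y w ^+ 2 <= n%:R * Q w.
Proof.
rewrite mulrC -ler_pdivrMr// -subr_ge0 -sum_sqr_deviation.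
by apply: sumr_ge0 => i _; exact: sqr_ge0.
Qed.

Lemma cosPhi_le1 w : -1 <= cosPhi w <= 1.
Proof.
rewrite -ler_norml /cosPhi normrM normfV [X in _ / X]ger0_norm ?mulr_ge0 ?sqrtr_ge0//.
have [->|q0] := eqVneq (Num.sqrt n%:R * Num.sqrt (Q w)) 0.
  by rewrite invr0 mulr0.
rewrite ler_pdivrMr ?mul1r; last by rewrite lt_neqAle eq_sym q0 mulr_ge0 ?sqrtr_ge0.
rewrite -sqrtr_sqr -sqrtrM ?ler0n// ler_sqrt; first exact: sqr_sum_le.
by rewrite mulr_ge0 ?ler0n// sumr_ge0// => i _; exact: sqr_ge0.
Qed.

Lemma cos_Phi w : cos (Phi X w) = cosPhi w.
Proof. by rewrite acosK// in_itv/= cosPhi_le1. Qed.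

Lemma sin_Phi w : sin (Phi X w) = Num.sqrt (1 - cosPhi w ^+ 2).
Proof. by rewrite sin_acos// cosPhi_le1. Qed.

Lemma tanPhiE w : tanPhi X w = Num.sqrt (1 - cosPhi w ^+ 2) / cosPhi w.
Proof. by rewrite /tanPhi /tan sin_Phi cos_Phi. Qed.

(** Thanks to 1 / 0 = 0 this holds also where the sine or the cosine vanishes. *)
Lemma cot_Phi w : cot (Phi X w) = (tanPhi X w)^-1.
Proof. by rewrite /cot cos_Phi sin_Phi tanPhiE invf_div. Qed.

(** The cosine decreases on [0, pi], which contains both angles. *)
Lemma phi_n_le w : (phi_n R n <= Phi X w) =
  (cosPhi w <= (Num.sqrt (1 + (1 / Num.sqrt (n%:R - 1)) ^+ 2))^-1).
Proof.
rewrite -cos_atan -/(phi_n R n) -cos_Phi.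
have Phi_pi : Phi X w \in `[0, pi].
  by rewrite in_itv/= acos_ge0 ?acos_lepi// cosPhi_le1.
have phi_pi : phi_n R n \in `[0, pi].
  rewrite in_itv/= /phi_n; apply/andP; split.
    by rewrite -(@atan0 R) le_atan// divr_ge0 ?sqrtr_ge0.
  rewrite (le_trans (ltW (atan_ltpi2 _)))// ler_pdivrMr// ler_peMr ?pi_ge0//.
  by rewrite ler1n.
have mono : {in `[0, pi] &, {mono (@cos R) : x y /~ x <= y}}.
  by move=> x y xp yp; rewrite !leNgt ltr_cos.
by rewrite mono.
Qed.

Lemma measurable_cosPhi : measurable_fun setT cosPhi.
Proof.
have mY : measurable_fun setT Y by apply: measurable_sum => i; exact: measurable_funP.
have mQ : measurable_fun setT Q.
  by apply: measurable_sum => i; apply: measurable_funX; exact: measurable_funP.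
apply: measurable_funM => //; apply: (measurableT_comp measurable_inv).
apply: measurable_funM => //; apply: (measurableT_comp _ mQ).
by apply: continuous_measurable_fun => ?; exact: sqrt_continuous.
Qed.

Lemma measurable_tanPhi : measurable_fun setT (tanPhi X).
Proof.
rewrite (_ : tanPhi X = fun w => Num.sqrt (1 - cosPhi w ^+ 2) / cosPhi w); last first.
  by apply/funext => w; exact: tanPhiE.
apply: measurable_funM; last exact: (measurableT_comp measurable_inv measurable_cosPhi).
apply: (@measurableT_comp _ _ _ _ _ _ (@Num.sqrt R)).
  by apply: continuous_measurable_fun => ?; exact: sqrt_continuous.
by apply: measurable_funB => //; apply: measurable_funX; exact: measurable_cosPhi.
Qed.

Section positive_sample.
Context (w : T) (X0 : forall i, 0 < X i w).

Lemma sum_gt0 : 0 < Y w.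
Proof.
have i0 : 'I_n by case: (n) n_ge2 => // k _; exact: ord0.
rewrite /Y (bigD1 i0)//= ltr_pwDl//.
by apply: sumr_ge0 => i _; exact: ltW.
Qed.

Let Q0 : 0 < Q w.
Proof.
have := sqr_sum_le w; have Y2 : 0 < Y w ^+ 2 by rewrite exprn_gt0// sum_gt0.
by move=> /(lt_le_trans Y2); rewrite pmulr_rgt0.
Qed.

Lemma cosPhi_gt0 : 0 < cosPhi w.
Proof. by rewrite divr_gt0 ?sum_gt0// mulr_gt0 ?sqrtr_gt0. Qed.

Lemma tanPhi_ge0 : 0 <= tanPhi X w.
Proof. by rewrite tanPhiE divr_ge0 ?sqrtr_ge0// ltW// cosPhi_gt0. Qed.

Let cosPhi2 : cosPhi w ^+ 2 = Y w ^+ 2 / (n%:R * Q w).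
Proof.
by rewrite /cosPhi expr_div_n exprMn !sqr_sqrtr ?ler0n// ltW.
Qed.

Lemma sqr_tanPhi : tanPhi X w ^+ 2 = n%:R * (Q w / Y w ^+ 2) - 1.
Proof.
rewrite tanPhiE expr_div_n sqr_sqrtr; last first.
  rewrite subr_ge0 cosPhi2 ler_pdivrMr ?mul1r ?sqr_sum_le//.
  by rewrite mulr_gt0.
rewrite mulrBl divff ?mul1r; last by rewrite expf_eq0/= gt_eqF// cosPhi_gt0.
by rewrite cosPhi2 invf_div mulrA.
Qed.

Lemma tanPhi_sqrt : tanPhi X w = Num.sqrt (n%:R * (Q w / Y w ^+ 2) - 1).
Proof. by rewrite -sqr_tanPhi sqrtr_sqr ger0_norm// tanPhi_ge0. Qed.

Lemma cosPhi_tan : cosPhi w = (Num.sqrt (1 + tanPhi X w ^+ 2))^-1.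
Proof.
rewrite sqr_tanPhi addrC subrK -sqrtrV; last first.
  by rewrite mulr_ge0 ?ler0n// divr_ge0 ?sqr_ge0// ltW.
rewrite [X in Num.sqrt X](_ : _ = cosPhi w ^+ 2).
  by rewrite sqrtr_sqr ger0_norm// ltW// cosPhi_gt0.
by rewrite cosPhi2 mulrA invf_div.
Qed.

Lemma phi_n_le_tan : (phi_n R n <= Phi X w) = (1 / Num.sqrt (n%:R - 1) <= tanPhi X w).
Proof.
rewrite phi_n_le cosPhi_tan; set t := 1 / _.
have t0 : 0 <= t by rewrite divr_ge0 ?sqrtr_ge0.
have s1 (z : R) : 0 < 1 + z ^+ 2 by rewrite ltr_pwDl// sqr_ge0.
rewrite lef_pV2 ?posrE ?sqrtr_gt0//.
rewrite ler_sqrt; last exact: ltW (s1 _).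
by rewrite lerD2l ler_sqr// nnegrE tanPhi_ge0.
Qed.

(** The squares of both sides are Q - Y ^ 2 / n. *)
Lemma sample_sd_tan : Num.sqrt (n%:R - 1) * sample_sd X w =
  Y w * tanPhi X w / Num.sqrt n%:R.
Proof.
rewrite /sample_sd sum_sqr_deviation -sqrtrM ?(ltW n1)// mulrA divff ?gt_eqF// mul1r.
rewrite -[RHS]ger0_norm; last first.
  by rewrite divr_ge0 ?sqrtr_ge0// mulr_ge0 ?tanPhi_ge0// ltW// sum_gt0.
rewrite -sqrtr_sqr; congr (Num.sqrt _).
rewrite expr_div_n sqr_sqrtr ?ler0n// exprMn sqr_tanPhi; field.
by rewrite !gt_eqF// sum_gt0.
Qed.

End positive_sample.
End sample_geometry.

(** * Joint law of the sum and of the tangent *)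

Section partial_sums.
Context d (T : measurableType d) (R : realType) (P : probability T R).
Context (N : nat) (X : 'I_N.+1 -> {RV P >-> R}) (a : nat).
Hypothesis X_indep : mutually_independent X.
Hypothesis X_gamma : forall i, is_density P (X i) (gamma_pdf a.+1%:R).
Local Notation mu := (@lebesgue_measure R).

Let x k : T -> R := X (inord k).

Fixpoint psum k : T -> R :=
  if k is k'.+1 then fun w => psum k' w + x k w else x 0.

(** The quotient (x_0 ^ 2 + ... + x_k ^ 2) / (x_0 + ... + x_k) ^ 2, in the recursive
    form that [gamma_step] produces. *)
Fixpoint pratio k : T -> R :=
  if k is k'.+1 then
    fun w => (1 - x k w / psum k w) ^+ 2 * pratio k' w + (x k w / psum k w) ^+ 2
  else fun=> 1.

(** Conjunctions of conditions on single variables are the events that mutual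
    independence speaks of, and they are stable under one more such condition, which
    is all that the induction asks for. *)
Definition future k : set (set T) :=
  [set E | exists (J : {set 'I_N.+1}) (A : 'I_N.+1 -> set R),
     [/\ forall i, i \in J -> (k < i)%N, forall i, measurable (A i) &
         E = \bigcap_(i in [set` J]) (X i @^-1` A i)]].

Let mX i (A : set R) : measurable A -> measurable (X i @^-1` A).
Proof. by move=> mA; rewrite -[X in measurable X]setTI; exact: measurable_funP. Qed.

Lemma measurable_future k E : future k E -> measurable E.
Proof.
move=> [J [A [_ mA ->]]].
apply: fin_bigcap_measurable => [|i _]; last exact: mX.
exact: finite_finset.
Qed.

Lemma future_setT k : future k setT.
Proof.
exists finset.set0, (fun=> setT); split => //; first by move=> i; rewrite inE.
by apply/seteqP; split => w // _ i /=; rewrite inE.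
Qed.

Lemma future_cons k E C : (k <= N)%N -> future k E -> measurable C ->
  (forall l, (l < k)%N -> future l (x k @^-1` C `&` E)) /\
  (P (x k @^-1` C `&` E) = P (x k @^-1` C) * P E)%E.
Proof.
move=> kN [J [A [hJ mA ->]]] mC.
have ik : (inord k : 'I_N.+1) = k :> nat by rewrite inordK.
have kJ : inord k \notin J by apply/negP => /hJ; rewrite ik ltnn.
pose A' i := if i == inord k then C else A i.
have mA' i : measurable (A' i) by rewrite /A'; case: ifP.
have AA' i : i \in J -> A' i = A i.
  by move=> iJ; rewrite /A'; case: eqP => // h; move: kJ; rewrite -h iJ.
have E' : x k @^-1` C `&` \bigcap_(i in [set` J]) (X i @^-1` A i) =
   \bigcap_(i in [set` (inord k |: J)%SET]) (X i @^-1` A' i).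
  apply/seteqP; split => w /=.
    move=> [xC h] i /=; rewrite in_setU1 => /orP[/eqP->|iJ].
      by rewrite /A' eqxx.
    by rewrite AA'//; exact: h.
  move=> h; split; first by have := h (inord k); rewrite /= setU11 /A' eqxx; apply.
  by move=> i iJ; rewrite -AA'//; apply: h; rewrite /= in_setU1 iJ orbT.
rewrite E'; split.
  move=> l lk; exists (inord k |: J)%SET, A'; split => // i.
  by rewrite in_setU1 => /orP[/eqP->|/hJ]; [rewrite ik|exact: ltn_trans].
rewrite (X_indep _ mA') (X_indep _ mA) big_setU1//=; congr (_ * _)%E.
  by rewrite /A' eqxx.
by apply: eq_bigr => i iJ; rewrite AA'.
Qed.

(** Induction on the number of variables, with [gamma_step] as the inductive step.
    For k = 0 the quotient is the constant 1, whose law has an atom; the first step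
    makes it absolutely continuous. *)
Lemma sum_ratio_law k : (k <= N)%N ->
  [/\ measurable_fun setT (psum k), measurable_fun setT (pratio k),
    forall w, 0 <= pratio k w,
    forall B, measurable B ->
      (P (psum k @^-1` B) = \int[mu]_(t in B) (gamma_pdf (a.+1 * k.+1)%:R t)%:E)%E &
    forall E A B, future k E -> measurable A -> measurable B ->
       (P (psum k @^-1` A `&` pratio k @^-1` B `&` E) =
        P E * (P (psum k @^-1` A) * P (pratio k @^-1` B)))%E] /\
  ((0 < k)%N -> forall M, measurable M -> mu M = 0%E -> P (pratio k @^-1` M) = 0%E).
Proof.
elim: k => [_|k ih kN].
  split => //; split => //.
  - exact: measurable_cst.
  - by move=> B mB; have [_ _ Xd] := X_gamma (inord 0); rewrite muln1; exact: Xd.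
  - move=> E A B FE mA mB /=.
    have PT : P setT = 1%E := probability_setT P.
    have [_ F2] := future_cons (leq0n N) FE mA.
    have [B1|B1] := pselect (B 1).
      rewrite (_ : (fun=> 1) @^-1` B = setT); last by apply/seteqP; split.
      by rewrite setIT F2 PT mule1 muleC.
    rewrite (_ : (fun=> 1) @^-1` B = set0); last by apply/seteqP; split.
    by rewrite setI0 set0I measure0 !mule0.
have [[mY mV V0 Yd ind] _] := ih (ltnW kN).
pose p := (a + k * a.+1)%N.
have p1 : (a.+1 * k.+1 = p.+1)%N by rewrite /p; lia.
have p2 : (a.+1 * k.+2 = (p + a).+2)%N by rewrite /p; lia.
have [_ _ Xd] := X_gamma (inord k.+1).
have mx : measurable_fun setT (x k.+1) by exact: measurable_funP.
have := @gamma_step _ T R P (psum k) (pratio k) (x k.+1) (future k.+1) p a mY mV mx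
  (@measurable_future k.+1) (future_setT _) _ Xd _.
rewrite p1 in Yd.
case=> [||d1 d2 d3].
- exact: Yd.
- move=> E A B C FE mA mB mC.
  have [F1 F2] := future_cons kN FE mC.
  have F1' := F1 k (ltnSn k).
  rewrite -setIA ind// F2; rewrite [(P _ * P E)%E]muleC -muleA; congr (_ * _)%E.
  by rewrite muleC.
split; last by move=> _ M mM M0; exact: d3.
split; [| | | |exact: d2].
- exact: measurable_funD.
- have mU : measurable_fun setT (fun w => x k.+1 w / (psum k w + x k.+1 w)).
    apply: measurable_funM => //; apply: (measurableT_comp measurable_inv).
    exact: measurable_funD.
  apply: measurable_funD; last exact: measurable_funX.
  by apply: measurable_funM => //; apply: measurable_funX; exact: measurable_funB.
- move=> w /=; apply: addr_ge0; last exact: sqr_ge0.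
  by apply: mulr_ge0; [exact: sqr_ge0|exact: V0].
- by move=> B mB; rewrite p2; exact: d1.
Qed.

Lemma psumE k w : psum k w = \sum_(j < k.+1) x j w.
Proof.
elim: k => [|k ih]; first by rewrite big_ord_recl big_ord0 addr0.
by rewrite big_ord_recr/= -ih.
Qed.

Lemma pratioE k w : (forall i, 0 < X i w) ->
  pratio k w * psum k w ^+ 2 = \sum_(j < k.+1) x j w ^+ 2.
Proof.
move=> X0.
have ps0 j : 0 < psum j w by elim: j => [|j ih] /=; [exact: X0|rewrite addr_gt0// X0].
elim: k => [|k ih]; first by rewrite big_ord_recl big_ord0 addr0 /= mul1r.
rewrite big_ord_recr/= -ih.
have := ps0 k.+1; rewrite /= => h; field.
by rewrite gt_eqF.
Qed.

Lemma sum_inord (f : 'I_N.+1 -> R) : \sum_(j < N.+1) f (inord j) = \sum_(j < N.+1) f j.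
Proof. by apply: eq_bigr => j _; rewrite inord_val. Qed.

End partial_sums.

Section sum_and_angle.
Context d (T : measurableType d) (R : realType) (P : probability T R).
Local Notation mu := (@lebesgue_measure R).

Lemma ae_positive (n : nat) (X : 'I_n -> {RV P >-> R}) (alpha : nat) : (0 < alpha)%N ->
  (forall i, is_density P (X i) (gamma_pdf alpha%:R)) ->
  {ae P, forall w, forall i, 0 < X i w}.
Proof.
move=> a0 Xg.
have Xneg i : P (X i @^-1` `]-oo, 0]) = 0%E.
  have [_ _ ->//] := Xg i.
  by apply: integral0_eq => t /=; rewrite in_itv/= => t0; rewrite gamma_pdf_le0.
apply: filter_forall => i; exists (X i @^-1` `]-oo, 0]); split => //.
- by rewrite -[X in measurable X]setTI; exact: measurable_funP.
- by move=> w /= /negP; rewrite -leNgt in_itv.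
Qed.

Lemma eq_measure_ae (E1 E2 : set T) : measurable E1 -> measurable E2 ->
  {ae P, forall w, E1 w <-> E2 w} -> P E1 = P E2.
Proof.
have le E E' : measurable E -> measurable E' ->
    {ae P, forall w, E w <-> E' w} -> (P E <= P E')%E.
  move=> mE mE' [N [mN N0 hN]].
  apply: (@le_trans _ _ (P (E' `|` N))).
    apply: le_measure; rewrite ?inE//; first exact: measurableU.
    move=> w Ew; have [|nE'] := pselect (E' w); first by left.
    by right; apply: hN => /= -[/(_ Ew)].
  apply: (le_trans (measureU2 _ mE' mN)).
  by move: N0 => /= ->; rewrite adde0.
move=> m1 m2 h; apply/eqP; rewrite eq_le !le//.
by apply: filterS h => w [].
Qed.

(** Almost surely tan Phi = sqrt (n V - 1), where V is the quotient of
    [sum_ratio_law]; affine maps and the square root preserve null sets. *)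
Lemma sum_tan_law (n : nat) (X : 'I_n -> {RV P >-> R}) (alpha : nat) : (0 < alpha)%N -> (2 <= n)%N ->
  mutually_independent X ->
  (forall i, is_density P (X i) (gamma_pdf alpha%:R)) ->
  let Y w := \sum_(i < n) X i w in
  [/\ forall B, measurable B ->
       (P (Y @^-1` B) = \int[mu]_(t in B) (gamma_pdf (alpha * n)%:R t)%:E)%E,
      forall A B, measurable A -> measurable B ->
       (P (tanPhi X @^-1` A `&` Y @^-1` B) =
        P (tanPhi X @^-1` A) * P (Y @^-1` B))%E &
      forall M, measurable M -> mu M = 0%E -> P (tanPhi X @^-1` M) = 0%E].
Proof.
case: n X => // N Z; case: alpha => // a _ N1 Zind Zg Y.
have [[mY mV V0 Yd ind] ac] := sum_ratio_law Zind Zg (leqnn N).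
have YE : psum Z N = Y.
  by apply/funext => w; rewrite psumE; exact: (sum_inord (fun j => Z j w)).
pose V := pratio Z N.
have good := ae_positive (ltn0Sn a) Zg.
have VE w : (forall i, 0 < Z i w) ->
    (\sum_(i < N.+1) Z i w ^+ 2) / Y w ^+ 2 = V w.
  move=> Z0; have := pratioE N Z0; rewrite (sum_inord (fun j => Z j w ^+ 2)) => <-.
  by rewrite YE mulfK// expf_eq0/= gt_eqF// (sum_gt0 N1 Z0).
have mT := measurable_tanPhi Z N1.
pose S (v : R) := Num.sqrt (N.+1%:R * v - 1).
have mS : measurable_fun setT S.
  apply: (@measurableT_comp _ _ _ _ _ _ (@Num.sqrt R)).
    by apply: continuous_measurable_fun => ?; exact: sqrt_continuous.
  by apply: measurable_funB => //; exact: measurable_funM.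
have mpre (f : T -> R) B : measurable_fun setT f -> measurable B -> measurable (f @^-1` B).
  by move=> mf mB; rewrite -[X in measurable X]setTI; exact: mf.
have mpreS B : measurable B -> measurable (S @^-1` B).
  by move=> mB; rewrite -[X in measurable X]setTI; exact: mS.
have TS w : (forall i, 0 < Z i w) -> tanPhi Z w = S (V w).
  by move=> Z0; rewrite (tanPhi_sqrt N1 Z0) (VE _ Z0).
have PT A : measurable A -> P (tanPhi Z @^-1` A) = P (V @^-1` (S @^-1` A)).
  move=> mA; apply: eq_measure_ae; [exact: mpre|exact: mpre (mpreS _ mA)|].
  by apply: filterS good => w /TS /= ->.
split.
- by move=> B mB; rewrite -YE; exact: Yd.
- move=> A B mA mB; rewrite PT//.
  have mSA := mpreS _ mA.
  rewrite (@eq_measure_ae _ (psum Z N @^-1` B `&` V @^-1` (S @^-1` A) `&` setT)).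
  + have PT1 : P setT = 1%E := probability_setT P.
    by rewrite ind// ?PT1 ?mul1e ?YE 1?muleC//; exact: future_setT.
  + by apply: measurableI; apply: mpre => //; rewrite -YE.
  + by rewrite setIT; apply: measurableI; apply: mpre.
  + by apply: filterS good => w /TS /= ->; rewrite YE; split => [[]|[[]]].
- move=> M mM M0.
  pose M1 := [set w : R | 0 <= w] `&` Num.sqrt @^-1` M.
  have mM1 : measurable M1.
    apply: measurableI; first by rewrite -set_itvcy; exact: measurable_itv.
    rewrite -[X in measurable X]setTI.
    by apply: continuous_measurable_fun => // ?; exact: sqrt_continuous.
  have M10 : mu M1 = 0%E by exact: null_preimage_sqrt.
  have nn : 0 < N.+1%:R :> R by rewrite ltr0n.
  have M20 := null_affine (-1) nn mM1 M10.
  rewrite -[RHS](ac _ _ _ M20)//; last first.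
    by rewrite -[X in measurable X]setTI; exact: measurable_affine.
  apply: eq_measure_ae; first exact: mpre.
    by apply: mpre => //; rewrite -[X in measurable X]setTI; exact: measurable_affine.
  apply: filterS good => w Z0 /=; rewrite (TS _ Z0) /M1 /=.
  have := sqr_ge0 (tanPhi Z w); rewrite (sqr_tanPhi N1 Z0) (VE _ Z0).
  by split => // -[].
Qed.

End sum_and_angle.

(** * Series of truncated moments *)

Section truncated_moments.
Context d (T : measurableType d) {R : realType} (P : probability T R).
Variables (tau : T -> R) (t0 : R) (m : nat).
Hypotheses (mtau : measurable_fun setT tau) (t00 : 0 < t0).
Let D := [set w | t0 <= tau w].

Lemma measurable_ge_cst : measurable D.
Proof.
rewrite (_ : D = tau @^-1` `[t0, +oo[).
  by rewrite -[X in measurable X]setTI; exact: mtau.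
by apply/seteqP; split => w /=; rewrite in_itv/= andbT.
Qed.
Let mD := measurable_ge_cst.

Let Doo : (P D < +oo)%E.
Proof. by rewrite ltey_eq fin_num_measure. Qed.

Lemma integrable_trunc (g : R -> R) (M : R) : measurable_fun setT g ->
  (forall t, t0 <= t -> `|g t| <= M) -> P.-integrable D (EFin \o (fun w => g (tau w))).
Proof.
move=> mg gM; apply: (@bounded_integrable _ _ _ _ _ _ M) => //.
  apply: measurable_funTS; exact: (@measurableT_comp _ _ _ _ _ _ g).
by move=> w; exact: gM.
Qed.

(** Where tau >= t0, a bound that holds for all t >= t0 is a constant bound. *)
Lemma cvg_series_trunc (g : nat -> R -> R) (b : nat -> R) (G : R -> R) :
  (forall k, measurable_fun setT (g k)) ->
  (forall k t, t0 <= t -> `|g k t| <= b k) -> cvgn (series b) ->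
  (forall t, t0 <= t -> series (g ^~ t) @ \oo --> G t) ->
  series (fun k => \int[P]_(w in D) g k (tau w)) @ \oo -->
  \int[P]_(w in D) G (tau w).
Proof.
move=> mg gb cb gG.
apply: (@cvg_series_Rintegral _ _ _ P D (fun k w => g k (tau w)) (fun w => G (tau w)) b) => //.
- move=> k; apply: measurable_funTS; exact: (@measurableT_comp _ _ _ _ _ _ (g k)).
- by move=> k w; exact: gb.
- by move=> w; exact: gG.
Qed.

Let mcdf x : measurable_fun setT (fun t : R => gamma_cdf m.+1%:R (x / t)).
Proof.
apply: (measurableT_comp (@measurable_gamma_cdf R m)).
by apply: measurable_funM => //; exact: measurable_inv.
Qed.

Lemma trunc_gamma_cdfZ c x :
  \int[P]_(w in D) (c * gamma_cdf m.+1%:R (x / tau w)) =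
  c * \int[P]_(w in D) gamma_cdf m.+1%:R (x / tau w).
Proof.
rewrite RintegralZl//; apply: (@integrable_trunc (fun t => gamma_cdf m.+1%:R (x / t)) 1) => //.
by move=> t _; rewrite ger0_norm ?gamma_cdf_ge0 ?gamma_cdf_le1.
Qed.

Definition cos_of_tan (t : R) := (Num.sqrt (1 + t ^+ 2))^-1.

Lemma measurable_cos_of_tan : measurable_fun setT cos_of_tan.
Proof.
apply: (measurableT_comp measurable_inv).
apply: (@measurableT_comp _ _ _ _ _ _ (@Num.sqrt R)).
  by apply: continuous_measurable_fun => ?; exact: sqrt_continuous.
by apply: measurable_funD => //; exact: measurable_funX.
Qed.

Lemma cos_of_tan_gt0 t : 0 < cos_of_tan t.
Proof. by rewrite invr_gt0 sqrtr_gt0 ltr_pwDl// sqr_ge0. Qed.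

Lemma cos_of_tan_lt1 t : 0 < t -> cos_of_tan t < 1.
Proof.
move=> t_gt0; rewrite invf_lt1 ?sqrtr_gt0 ?ltr_pwDl ?sqr_ge0//.
rewrite -[ltLHS]sqrtr1 ltr_sqrt ?ltrDl ?exprn_gt0//.
by rewrite ltr_pwDl ?sqr_ge0.
Qed.

Lemma cos_of_tan_le t t' : 0 <= t -> t <= t' -> cos_of_tan t' <= cos_of_tan t.
Proof.
move=> t_ge0 tt'; rewrite lef_pV2 ?posrE ?sqrtr_gt0 ?ltr_pwDl ?sqr_ge0//.
rewrite ler_sqrt; last by rewrite addr_ge0 ?sqr_ge0.
by rewrite lerD2l ler_sqr ?nnegrE// (le_trans t_ge0).
Qed.

Lemma tan_of_cos_of_tan t : 0 < t ->
  cos_of_tan t / Num.sqrt (1 - cos_of_tan t ^+ 2) = t^-1.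
Proof.
move=> t_gt0; have h : 0 < 1 + t ^+ 2 by rewrite ltr_pwDl ?sqr_ge0.
have h' : Num.sqrt (1 + t ^+ 2) != 0 by rewrite gt_eqF ?sqrtr_gt0.
rewrite (_ : 1 - _ = (t * cos_of_tan t) ^+ 2).
  rewrite sqrtr_sqr ger0_norm; last by rewrite mulr_ge0 ?ltW ?cos_of_tan_gt0.
  by have := cos_of_tan_gt0 t => c0; field; rewrite gt_eqF//= gt_eqF.
rewrite exprMn /cos_of_tan exprVn sqr_sqrtr ?ltW//.
by field; rewrite gt_eqF.
Qed.

(** Termwise integration of [cvg_gamma_cdf_angle]. The terms increase with the
    cosine, hence are largest at [t0], where the cosine is still less than 1. *)
Lemma cvg_series_cos x : 0 < x ->
  series (fun k => (-1) ^+ k *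
    (\int[P]_(w in D) cos_of_tan (tau w) ^+ (m.+1 + k) / (m.+1 + k)%:R) *
    (Ppoly m.+1 k).[x]) @ \oo -->
  (x ^+ m.+1 / Gamma m.+1%:R)^-1 *
    \int[P]_(w in D) gamma_cdf m.+1%:R (x / tau w).
Proof.
move=> x0; rewrite -trunc_gamma_cdfZ.
have mc k : measurable_fun setT (fun t => cos_of_tan t ^+ (m.+1 + k)).
  by apply: measurable_funX; exact: measurable_cos_of_tan.
have q0 := cos_of_tan_gt0 t0; have q1 := cos_of_tan_lt1 t00.
have coef k : 0 <= (m.+1 + k)%:R^-1 * (Ppoly m.+1 k).[x].
  have := angle_term_ge0 m x0 q0 k.
  by rewrite /angle_term pmulr_rge0// exprn_gt0.
rewrite (_ : (fun k => _ * _ * _) = fun k =>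
   \int[P]_(w in D) ((-1) ^+ k * angle_term m x (cos_of_tan (tau w)) k)); last first.
  apply/funext => k; rewrite /angle_term.
  under [RHS]eq_Rintegral do rewrite mulrCA mulrC.
  rewrite RintegralZl//; first by ring.
  apply: (@integrable_trunc (fun t => cos_of_tan t ^+ (m.+1 + k)) 1) => // t t0t.
  have c0 := ltW (cos_of_tan_gt0 t); rewrite ger0_norm ?exprn_ge0//.
  by apply: exprn_ile1 => //; apply/ltW/cos_of_tan_lt1; exact: lt_le_trans t0t.
apply: (@cvg_series_trunc (fun k t => (-1) ^+ k * angle_term m x (cos_of_tan t) k)
  (angle_term m x (cos_of_tan t0))
  (fun t => (x ^+ m.+1 / Gamma m.+1%:R)^-1 * gamma_cdf m.+1%:R (x / t))).
- by move=> k; apply: measurable_funM => //; apply: measurable_funM.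
- move=> k t t0t; rewrite normrM normrX normrN normr1 expr1n mul1r.
  have ct := cos_of_tan_gt0 t.
  rewrite ger0_norm ?angle_term_ge0// /angle_term ler_wpM2r//.
  by rewrite -[leLHS]ger0_norm ?exprn_ge0 ?norm_exprn_le ?(ltW ct)// cos_of_tan_le// ltW.
- exact: is_cvg_angle_term.
- move=> t t0t; have t_gt0 : 0 < t by exact: lt_le_trans t0t.
  by rewrite -(tan_of_cos_of_tan t_gt0); apply: cvg_gamma_cdf_angle => //;
     [exact: cos_of_tan_gt0 | exact: cos_of_tan_lt1].
Qed.

Let inv_le t : t0 <= t -> 0 < t^-1 <= t0^-1.
Proof.
move=> t0t; have t_gt0 : 0 < t by exact: lt_le_trans t0t.
by rewrite invr_gt0 t_gt0 lef_pV2.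
Qed.

(** Termwise integration of [cvg_gamma_cdf_powers], with the absolute values of the
    terms at [t0] as bounds. *)
Lemma cvg_series_cot x : 0 < x ->
  series (fun k => \int[P]_(w in D) (tau w)^-1 ^+ (m.+1 + k) / (m.+1 + k)%:R *
    ((- x) ^+ k / k`!%:R)) @ \oo -->
  (x ^+ m.+1 / Gamma m.+1%:R)^-1 *
    \int[P]_(w in D) gamma_cdf m.+1%:R (x / tau w).
Proof.
move=> x0; rewrite -trunc_gamma_cdfZ.
have mc k : measurable_fun setT (fun t : R => t^-1 ^+ (m.+1 + k)).
  by apply: measurable_funX; exact: measurable_inv.
rewrite (_ : (fun k => _ / _ * _) = fun k =>
   \int[P]_(w in D) ((tau w)^-1 ^+ (m.+1 + k) / (m.+1 + k)%:R * ((- x) ^+ k / k`!%:R)));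
  last first.
  apply/funext => k; under [RHS]eq_Rintegral do rewrite -mulrA mulrC.
  rewrite RintegralZl//; first by ring.
  apply: (@integrable_trunc (fun t => t^-1 ^+ (m.+1 + k)) (t0^-1 ^+ (m.+1 + k))) => // t.
  by move=> /inv_le/andP[a b]; apply: norm_exprn_le => //; exact: ltW.
apply: (@cvg_series_trunc (fun k t => t^-1 ^+ (m.+1 + k) / (m.+1 + k)%:R * ((- x) ^+ k / k`!%:R))
  (fun k => t0^-1 ^+ (m.+1 + k) / (m.+1 + k)%:R * (x ^+ k / k`!%:R))
  (fun t => (x ^+ m.+1 / Gamma m.+1%:R)^-1 * gamma_cdf m.+1%:R (x / t))).
- by move=> k; apply: measurable_funM => //; apply: measurable_funM.
- move=> k t /inv_le/andP[a b]; rewrite normrM [(- x) ^+ k]exprNn -[_ * _ / k`!%:R]mulrA.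
  rewrite [X in _ * X]normrM normrX normrN normr1 expr1n mul1r.
  rewrite [X in _ * X]ger0_norm; last by rewrite divr_ge0// exprn_ge0// ltW.
  rewrite ler_wpM2r//; first by rewrite divr_ge0// exprn_ge0// ltW.
  rewrite normrM [X in _ * X]ger0_norm ?invr_ge0//.
  by rewrite ler_wpM2r ?invr_ge0// norm_exprn_le// ltW.
- by apply: is_cvg_gamma_powers; rewrite ?invr_ge0 ltW.
- by move=> t /inv_le/andP[a b]; exact: cvg_gamma_cdf_powers.
Qed.

(** Termwise integration of [cvg_gamma_cdf_binomial]; the binomial expansion of
    (1 - kappa / tau) ^ k is what makes the k-th difference of the moments appear. *)
Lemma cvg_series_difference (kappa y : R) : 0 < kappa -> 0 < y ->
  series (fun k => (\sum_(l < k.+1) (-1) ^+ l * 'C(k, l)%:R *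
      \int[P]_(w in D) (kappa * (tau w)^-1) ^+ (m.+1 + l)) *
    'C(m.+1 + k - 1, k)%:R * gamma_cdf (m.+1 + k)%:R y) @ \oo -->
  \int[P]_(w in D) gamma_cdf m.+1%:R (kappa * y / tau w).
Proof.
move=> k0 y0; pose Z (t : R) := kappa * t^-1.
have mZ : measurable_fun setT Z by apply: measurable_funM => //; exact: measurable_inv.
pose zeta := kappa / t0.
have Zt t : t0 <= t -> 0 < Z t <= zeta.
  by move=> /inv_le/andP[a b]; rewrite /Z mulr_gt0//= ler_wpM2l// ltW.
have iZ l : P.-integrable D (EFin \o (fun w => Z (tau w) ^+ (m.+1 + l))).
  apply: (@integrable_trunc (fun t => Z t ^+ (m.+1 + l)) (zeta ^+ (m.+1 + l))).
    exact: measurable_funX.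
  move=> t /Zt/andP[a b].
  by apply: norm_exprn_le => //; exact: ltW.
pose C k := 'C(m.+1 + k - 1, k)%:R * gamma_cdf (m.+1 + k)%:R y.
have C0 k : 0 <= C k.
  by rewrite mulr_ge0// addSn gamma_cdf_ge0.
rewrite (_ : (fun k => _ * _ * _) = fun k =>
   \int[P]_(w in D) (Z (tau w) ^+ m.+1 * (1 - Z (tau w)) ^+ k * C k)); last first.
  apply/funext => k; rewrite -mulrA -/(C k).
  have E w : Z (tau w) ^+ m.+1 * (1 - Z (tau w)) ^+ k * C k =
      \sum_(l < k.+1) C k * ((-1) ^+ l * 'C(k, l)%:R) * Z (tau w) ^+ (m.+1 + l).
    rewrite exprBn mulr_sumr mulr_suml; apply: eq_bigr => l _.
    rewrite expr1n exprD -[in LHS]mulr_natl; ring.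
  under [RHS]eq_Rintegral do rewrite E.
  rewrite Rintegral_sum//; last first.
    move=> l; rewrite (_ : _ \o _ = fun w =>
      ((C k * ((-1) ^+ l * 'C(k, l)%:R))%:E * (Z (tau w) ^+ (m.+1 + l))%:E)%E)//.
    by apply: integrableZl => //; exact: iZ.
  rewrite mulr_suml; apply: eq_bigr => l _.
  by rewrite [RHS]RintegralZl// mulrC mulrA.
apply: (@cvg_series_trunc (fun k t => Z t ^+ m.+1 * (1 - Z t) ^+ k * C k)
  (fun k => zeta ^+ m.+1 * (1 + zeta) ^+ k * C k)
  (fun t => gamma_cdf m.+1%:R (kappa * y / t))).
- move=> k; apply: measurable_funM => //; apply: measurable_funM; apply: measurable_funX => //.
  by apply: measurable_funB.
- move=> k t /Zt/andP[a b].
  have z0 : 0 < zeta by exact: lt_le_trans b.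
  rewrite normrM [`|C k|]ger0_norm// ler_wpM2r// normrM !normrX.
  apply: ler_pM; rewrite ?exprn_ge0 ?normr_ge0//.
    by rewrite -normrX norm_exprn_le// ltW.
  rewrite lerXn2r ?nnegrE ?normr_ge0 ?addr_ge0 ?(ltW z0)//.
  by rewrite (le_trans (ler_normB _ _))// normr1 lerD2l ger0_norm// ltW.
(* The dominating series is the same expansion at the negative rate - zeta. *)
- have := @cvg_gamma_lower R m 1 (- zeta) y (ltW y0).
  rewrite opprK => /(cvg_seriesZ (c := zeta ^+ m.+1 / m`!%:R)) => /cvgP.
  rewrite (_ : (fun k => _ / _ * _) = fun k => zeta ^+ m.+1 * (1 + zeta) ^+ k * C k)//.
  by apply/funext => k; rewrite /C gamma_cdf_binomialE; ring.
- move=> t /Zt/andP[a b]; rewrite [kappa * y / t](_ : _ = Z t * y); last by rewrite /Z mulrAC.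
  exact: cvg_gamma_cdf_binomial.
Qed.

End truncated_moments.

(** * Distribution of the product of the sum and the tangent *)

Section independent_pair.
Context d (T : measurableType d) (R : realType) (P : probability T R).
Local Notation mu := (@lebesgue_measure R).
Local Notation GR := (measurableTypeR R).
Variables (U V : T -> R) (mU : measurable_fun setT U) (mV : measurable_fun setT V).
Hypothesis UV : forall A B, measurable A -> measurable B ->
  P (U @^-1` A `&` V @^-1` B) = (P (U @^-1` A) * P (V @^-1` B))%E.

Lemma measurable_slice (C : set (GR * GR)) : measurable C ->
  measurable_fun setT (fun u : GR => P [set w | C (u, V w)]).
Proof.
move=> mC; have := measurable_fun_xsection (distribution P (law mV)) mC.
rewrite /comp; congr (measurable_fun _ _); apply/funext => u /=.
by rewrite /pushforward; congr (P _); apply/seteqP; split => w; rewrite /= xsectionE.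
Qed.

(** Conditioning on [U]. *)
Lemma independent_slice (I : set R) (C : set (GR * GR)) :
  measurable I -> measurable C ->
  (P [set w | I (U w) /\ C (U w, V w)] =
   \int[distribution P (law mU)]_(u in I) P [set w | C (u, V w)])%E.
Proof.
move=> mI mC.
have mIC : measurable ((I `*` setT) `&` C : set (GR * GR)).
  by apply: measurableI => //; exact: measurableX.
have H := @product_law _ _ _ P _ _ GR GR setT _ _ (distribution P (law mU))
  (distribution P (law mV)) _ measurableT mU mV _ mIC.
have := H _; rewrite probability_setT mul1e setIT => {}H.
rewrite (_ : [set w | _] = (fun w => (U w, V w)) @^-1` ((I `*` setT) `&` C)); last first.
  by apply/seteqP; split => w /=; [move=> [? ?] | move=> [[? _] ?]].
rewrite H => [|A B mA mB]; last by rewrite setIT mul1e; exact: UV.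
rewrite /product_measure1 [RHS]integral_mkcond; apply: eq_integral => u _ /=.
rewrite patchE; case: ifPn => uI; rewrite /pushforward.
  congr (P _); apply/seteqP; split => w; rewrite /= xsectionE//=.
    by move=> [].
  by move=> ?; split => //; split => //; exact: set_mem.
rewrite (_ : xsection _ _ = set0) ?measure0//; apply/seteqP; split => w //=.
by rewrite xsectionE/= => -[[/mem_set]]; rewrite (negbTE uI).
Qed.

End independent_pair.

Section product_tails.
Context d (T : measurableType d) (R : realType) (P : probability T R).
Local Notation mu := (@lebesgue_measure R).
Local Notation GR := (measurableTypeR R).
Variables (Y tau : T -> R) (m : nat) (t0 : R).
Hypotheses (mY : measurable_fun setT Y) (mtau : measurable_fun setT tau).
Hypothesis t00 : 0 < t0.
Hypothesis Yd : forall B, measurable B ->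
  (P (Y @^-1` B) = \int[mu]_(y in B) (gamma_pdf m.+1%:R y)%:E)%E.
Hypothesis ind : forall A B, measurable A -> measurable B ->
  P (tau @^-1` A `&` Y @^-1` B) = (P (tau @^-1` A) * P (Y @^-1` B))%E.
Hypothesis ac : forall M, measurable M -> mu M = 0%E -> P (tau @^-1` M) = 0%E.
Hypothesis tau_ge0 : {ae P, forall w, 0 <= tau w}.

Let mpre (Z : T -> R) (B : set R) : measurable_fun setT Z -> measurable B ->
  measurable (Z @^-1` B).
Proof. by move=> mZ mB; rewrite -[X in measurable X]setTI; exact: mZ. Qed.

Let ae_neq (c : R) : {ae P, forall w, tau w != c}.
Proof.
exists (tau @^-1` [set c]); split; first exact: mpre.
  by apply: ac => //; exact: lebesgue_measure_set1.
by move=> w /= /negP; rewrite negbK => /eqP.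
Qed.

Let ae_Y_gt0 : {ae P, forall w, 0 < Y w}.
Proof.
exists (Y @^-1` `]-oo, 0%R]); split; first exact: mpre.
  rewrite Yd// integral0_eq// => y; rewrite /= in_itv/= => y0.
  by rewrite gamma_pdf_le0.
by move=> w /= /negP; rewrite -leNgt in_itv.
Qed.

Lemma gamma_cdf_prob z : P (Y @^-1` `]-oo, z]) = (gamma_cdf m.+1%:R z)%:E.
Proof.
rewrite Yd// -integral_gamma_cdf [LHS]integral_mkcond [RHS]integral_mkcond.
apply: eq_integral => y _; rewrite !patchE.
have [y0|y0] := leP 0 y; last first.
  by rewrite gamma_pdf_le0 ?ltW//; case: ifPn; case: ifPn.
by rewrite !mem_setE !in_itv/= y0.
Qed.

Let mprod (x : R) : measurable [set z : GR * GR | z.2 * z.1 <= x].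
Proof.
have mf : measurable_fun setT (fun z : GR * GR => z.2 * z.1 : R) by exact: measurable_funM.
rewrite (_ : [set _ | _] = (fun z : GR * GR => z.2 * z.1) @^-1` `]-oo, x]).
  by rewrite -[X in measurable X]setTI; exact: mf.
by apply/seteqP; split => z /=; rewrite in_itv.
Qed.

Let prod_slice (x : R) (I : set R) : measurable I -> (forall t, I t -> 0 < t) ->
  (P [set w | I (tau w) /\ (Y w * tau w <= x)%R] =
   \int[distribution P (law mtau)]_(t in I) (gamma_cdf m.+1%:R (x / t))%:E)%E.
Proof.
move=> mI I0.
have := @independent_slice _ _ _ P tau Y mtau mY ind I _ mI (mprod x).
move=> /= ->; apply: eq_integral => t /set_mem/I0 t_gt0.
rewrite -gamma_cdf_prob; congr (P _); apply/seteqP; split => w /=;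
  by rewrite in_itv/= ler_pdivlMr.
Qed.

Let D := [set w | t0 <= tau w].

Let mcdf x : measurable_fun setT (fun t : GR => (gamma_cdf m.+1%:R (x / t))%:E).
Proof.
apply/measurable_EFinP; apply: (measurableT_comp (@measurable_gamma_cdf R m)).
by apply: measurable_funM => //; exact: measurable_inv.
Qed.

Let mD : measurable D := measurable_ge_cst t0 mtau.

Let mE x : measurable [set w | Y w * tau w <= x].
Proof.
rewrite (_ : [set _ | _] = (fun w => Y w * tau w) @^-1` `]-oo, x]).
  by apply: mpre => //; exact: measurable_funM.
by apply/seteqP; split => w /=; rewrite in_itv.
Qed.

Let mI (I : set R) x : measurable I -> measurable [set w | I (tau w) /\ Y w * tau w <= x].
Proof. by move=> ?; exact: (measurableI _ _ (mpre mtau _) (mE x)). Qed.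

(** Given tau = t, the event is Y <= x / t. *)
Lemma prob_far x :
  P [set w | t0 <= tau w /\ Y w * tau w <= x] =
   (\int[P]_(w in D) gamma_cdf m.+1%:R (x / tau w))%:E.
Proof.
have h : (P [set w | (t0 <= tau w)%R /\ (Y w * tau w <= x)%R] =
   \int[P]_(w in D) (gamma_cdf m.+1%:R (x / tau w))%:E)%E.
  rewrite (_ : [set w | _ /\ _] = [set w | `[t0, +oo[%classic (tau w) /\ (Y w * tau w <= x)%R]).
    rewrite prod_slice//; last by move=> t /=; rewrite in_itv/= andbT; exact: lt_le_trans.
    have H := @ge0_integral_pushforward _ _ _ GR R tau mtau P `[t0, +oo[%classic
      (fun t : GR => (gamma_cdf m.+1%:R (x / t))%:E).
    have H2 : {in `[t0, +oo[%classic, forall t : GR, (0%R <= (gamma_cdf m.+1%:R (x / t))%:E)%E}.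
      by move=> t _; rewrite lee_fin gamma_cdf_ge0.
    have H1 := measurable_funS measurableT (@subsetT _ `[t0, +oo[%classic) (mcdf x).
    apply: etrans (H _ H1 H2) _ => //.
    by congr (integral _ _ _); apply/seteqP; split => w /=; rewrite in_itv/= andbT.
  by apply/seteqP; split => w /=; rewrite in_itv/= andbT.
rewrite /Rintegral fineK// -h fin_num_measure//.
exact: (measurableI _ _ mD (mE x)).
Qed.

(** The values 0 and [t0] of [tau] have probability 0, so it does not matter on which
    side of the cut they are counted. *)
Lemma prob_split x : P [set w | Y w * tau w <= x] =
  ((\int[P]_(w in D) gamma_cdf m.+1%:R (x / tau w))%:E +
   P [set w | `]0%R, t0]%classic (tau w) /\ (Y w * tau w <= x)%R])%E.
Proof.
rewrite -prob_far.
have mN : measurable [set w | `]-oo, t0[%classic (tau w) /\ Y w * tau w <= x] by exact: mI.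
transitivity (P ([set w | t0 <= tau w /\ Y w * tau w <= x] `|`
   [set w | `]-oo, t0[%classic (tau w) /\ Y w * tau w <= x])).
  congr (P _); apply/seteqP; split => w /=; last by move=> [|] [].
  by move=> Yx; rewrite in_itv/=; case: (leP t0 (tau w)); [left | right].
rewrite measureU//; last 2 first.
  exact: (measurableI _ _ mD (mE x)).
  apply/seteqP; split => w //= -[[h _] []]; rewrite in_itv/= ltNge.
  by rewrite h.
congr (_ + _)%E; apply: eq_measure_ae => //; first exact: mI.
have h1 := ae_neq 0; have h2 := ae_neq t0.
apply: filterS3 h1 h2 tau_ge0 => w w0 wt0 w_ge0 /=.
rewrite !in_itv/= lt_neqAle wt0/= lt_neqAle eq_sym w0 w_ge0/=.
by [].
Qed.

(** Conditioning on [tau]. *)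
Lemma prob_near_angle x w : is_density P tau w ->
  P [set w | `]0, t0]%classic (tau w) /\ Y w * tau w <= x] =
  (\int[mu]_(t in `[0, t0]) (gamma_cdf m.+1%:R (x / t) * w t))%:E.
Proof.
move=> [mw w0 wd].
have mcw : measurable_fun setT (fun t : GR => (gamma_cdf m.+1%:R (x / t) * w t)%:E).
  apply/measurable_EFinP; apply: measurable_funM => //.
  by apply/measurable_EFinP; exact: mcdf.
have h : P [set w | `]0, t0]%classic (tau w) /\ Y w * tau w <= x] =
    (\int[mu]_(t in `[0%R, t0]) (gamma_cdf m.+1%:R (x / t) * w t)%:E)%E.
  rewrite prod_slice//; last by move=> t /=; rewrite in_itv/= => /andP[].
  rewrite (ge0_integral_density (f := w))//.
  - rewrite -integral_itv_obnd_cbnd; last exact: measurable_funTS.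
    by apply: eq_integral => t _; rewrite EFinM.
  - by apply: measurable_funTS; exact: mcdf.
  - by move=> t; rewrite lee_fin gamma_cdf_ge0.
rewrite /Rintegral fineK// -h fin_num_measure//; exact: mI.
Qed.

(** Conditioning on Y = y instead: the conditions tau <= t0 and y tau <= x amount to
    tau <= t0 if y < x / t0, and to tau <= x / y otherwise. *)
Lemma prob_near_sum x (b := x / t0) (V := fun t => fine (P [set w | tau w <= t])) :
  0 < x ->
  P [set w | `]0, t0]%classic (tau w) /\ Y w * tau w <= x] =
  (V t0 * gamma_cdf m.+1%:R b +
   \int[mu]_(y in `[b, +oo[) (gamma_pdf m.+1%:R y * V (x / y)))%:E.
Proof.
move=> x0.
have b0 : 0 < b by rewrite divr_gt0.
have mle t : measurable [set w | tau w <= t].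
  rewrite (_ : [set _ | _] = tau @^-1` `]-oo, t]); first exact: mpre.
  by apply/seteqP; split => w /=; rewrite in_itv.
have VE t : P [set w | tau w <= t] = (V t)%:E by rewrite fineK// fin_num_measure.
have V0 t : 0 <= V t by rewrite fine_ge0.
pose C := [set z : GR * GR | z.2 <= t0 /\ z.2 * z.1 <= x].
have mC : measurable C.
  apply: (measurableI _ _ _ (mprod x)).
  rewrite (_ : (fun _ => _) = (fun z : GR * GR => z.2) @^-1` `]-oo, t0]).
    by rewrite -[X in measurable X]setTI; exact: measurable_snd.
  by apply/seteqP; split => z /=; rewrite in_itv.
have ind' A B : measurable A -> measurable B ->
    P (Y @^-1` A `&` tau @^-1` B) = (P (Y @^-1` A) * P (tau @^-1` B))%E.
  by move=> mA mB; rewrite setIC ind// muleC.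
pose h y := P [set w | C (y, tau w)].
have mh : measurable_fun setT (h : GR -> \bar R) := measurable_slice P mtau mC.
have h1 y : 0 < y -> y < b -> h y = (V t0)%:E.
  move=> y0 yb; rewrite -VE; congr (P _); apply/seteqP; split => w /=; first by case.
  move=> wt0; split => //; rewrite mulrC.
  apply: (@le_trans _ _ (y * t0)); first by rewrite ler_wpM2l// ltW.
  by rewrite -ler_pdivlMr// ltW.
have h2 y : b <= y -> h y = (V (x / y))%:E.
  move=> yb; have y0 : 0 < y by exact: lt_le_trans yb.
  rewrite -VE; congr (P _); apply/seteqP; split => w /=.
    by case => _; rewrite ler_pdivlMr.
  move=> wy; split; last by rewrite -ler_pdivlMr.
  by rewrite (le_trans wy)// ler_pdivrMr// mulrC -ler_pdivrMr.
pose g y := (h y * (gamma_pdf m.+1%:R y)%:E)%E.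
have mg : measurable_fun setT (g : GR -> \bar R).
  by apply: emeasurable_funM => //; apply/measurable_EFinP; exact: measurable_gamma_pdf.
have g0 y : (0 <= g y)%E by rewrite mule_ge0// lee_fin gamma_pdf_ge0.
have step1 : P [set w | `]0, t0]%classic (tau w) /\ Y w * tau w <= x] =
    (\int[mu]_(y in `]0%R, +oo[) g y)%E.
  transitivity (P [set w | `]0, +oo[%classic (Y w) /\ C (Y w, tau w)]).
    apply: eq_measure_ae; first exact: mI.
      have mC' : measurable [set w | tau w <= t0 /\ tau w * Y w <= x].
        apply: (measurableI _ _ (mle t0)).
        by have := mE x; under eq_fun do rewrite mulrC.
      by apply: (measurableI _ _ _ mC'); exact: mpre.
    have h3 := ae_neq 0.
    apply: filterS3 h3 tau_ge0 ae_Y_gt0 => w w0 w_ge0 Yw /=.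
    rewrite !in_itv/= Yw lt_neqAle eq_sym w0 w_ge0/= mulrC.
    by split => [[? ?]|[_ []]].
  rewrite (independent_slice mY mtau ind' _ mC)//.
  apply: (@ge0_integral_density R (distribution P (law mY)) (gamma_pdf m.+1%:R) _ h) => //.
  - exact: measurable_gamma_pdf.
  - exact: gamma_pdf_ge0.
  - exact: measurable_funTS.
have split_b : `]0%R, +oo[%classic = `]0%R, b[%classic `|` `[b, +oo[%classic :> set R.
  apply/seteqP; split => y /=; rewrite !in_itv/= !andbT.
    by move=> ->/=; case: (ltP y b); [left|right].
  by case => [/andP[]//|]; exact: lt_le_trans.
have step2 : (\int[mu]_(y in `]0%R, +oo[) g y = (V t0 * gamma_cdf m.+1%:R b)%:E +
    \int[mu]_(y in `[b, +oo[) (gamma_pdf m.+1%:R y * V (x / y))%:E)%E.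
  rewrite split_b ge0_integral_setU//; last 2 first.
    exact: measurable_funTS.
    apply/disj_setPS => y /=; rewrite !in_itv/= andbT => -[/andP[_ +]].
    by rewrite ltNge => /negP.
  congr (_ + _)%E; last first.
    apply: eq_integral => y /set_mem/=; rewrite in_itv/= andbT => yb.
    by rewrite /g h2// -EFinM mulrC.
  have mp : measurable_fun setT (fun y : GR => (gamma_pdf m.+1%:R y)%:E).
    by apply/measurable_EFinP; exact: measurable_gamma_pdf.
  rewrite EFinM -integral_gamma_cdf -integral_itv_bndo_bndc; last exact: measurable_funTS.
  rewrite -integral_itv_obnd_cbnd; last exact: measurable_funTS.
  rewrite -ge0_integralZl//; last 3 first.
    exact: measurable_funTS.
    by move=> y _; rewrite lee_fin gamma_pdf_ge0.
    by rewrite lee_fin.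
  apply: eq_integral => y /set_mem/=; rewrite in_itv/= => /andP[y0 yb].
  by rewrite /g h1.
rewrite EFinD /Rintegral fineK ?step1 ?step2//.
have : ((V t0 * gamma_cdf m.+1%:R b)%:E +
    \int[mu]_(y in `[b, +oo[) (gamma_pdf m.+1%:R y * V (x / y))%:E)%E \is a fin_num.
  by rewrite -step2 -step1 fin_num_measure//; exact: mI.
by rewrite fin_numD => /andP[].
Qed.

End product_tails.

(** * Truncated expectations as integrals in the tangent *)

Section truncated_expectation.
Context d (T : measurableType d) (R : realType) (P : probability T R).
Local Notation mu := (@lebesgue_measure R).
Local Notation GR := (measurableTypeR R).

(** The Radon-Nikodym theorem. *)
Lemma density_exists (Z : T -> R) : measurable_fun setT Z ->
  (forall M, measurable M -> mu M = 0%E -> P (Z @^-1` M) = 0%E) ->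
  exists w, is_density P Z w.
Proof.
move=> mZ ac; pose nu : {finite_measure set GR -> \bar R} := distribution P (law mZ).
have dom : nu `<< mu by apply/null_content_dominatesP => M mM M0; exact: ac.
exists (fine \o Radon_Nikodym_SigmaFinite.f nu mu); split.
- have /measurable_int := Radon_Nikodym_SigmaFinite.f_integrable dom.
  by move=> h; apply: measurableT_comp.
- by move=> t /=; rewrite fine_ge0// Radon_Nikodym_SigmaFinite.f_ge0.
- move=> M mM; rewrite -[LHS]/(nu M) (Radon_Nikodym_SigmaFinite.f_integral dom mM).
  by apply: eq_integral => t _; rewrite /= fineK// Radon_Nikodym_SigmaFinite.f_fin_num.
Qed.

Context (n : nat) (X : 'I_n -> {RV P >-> R}) (alpha : nat).
Hypotheses (n_ge2 : (2 <= n)%N) (alpha_gt0 : (0 < alpha)%N).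
Hypothesis X_gamma : forall i, is_density P (X i) (gamma_pdf alpha%:R).

Let t0 : R := 1 / Num.sqrt (n%:R - 1).

(** The two truncations and the two integrands agree as soon as all the X_i are
    positive, hence almost surely. *)
Lemma Ebar_tan (f h : R -> R) :
  measurable_fun setT (fun w => f (Phi X w)) -> measurable_fun setT h ->
  (forall w, (forall i, 0 < X i w) -> f (Phi X w) = h (tanPhi X w)) ->
  Ebar X f = \int[P]_(w in [set w | t0 <= tanPhi X w]) h (tanPhi X w).
Proof.
move=> mf mh fh; have mtan := measurable_tanPhi X n_ge2.
have mD := measurable_ge_cst t0 mtan.
have mE : measurable [set w | phi_n R n <= Phi X w].
  rewrite (_ : [set _ | _] = cosPhi X @^-1` `]-oo, (Num.sqrt (1 + t0 ^+ 2))^-1]).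
    by rewrite -[X in measurable X]setTI; exact: measurable_cosPhi.
  by apply/seteqP; split => w; rewrite /= in_itv/= phi_n_le.
rewrite /Ebar unlock /Rintegral; congr fine; rewrite [RHS]integral_mkcond.
apply: ae_eq_integral => //.
- apply/measurable_EFinP; apply: measurable_funM => //; exact: measurable_indic.
- apply/(measurable_restrictT _ mD).1; apply: measurable_funTS.
  by apply/measurable_EFinP; exact: (measurableT_comp mh).
have := ae_positive alpha_gt0 X_gamma; apply: filterS => w w0 _.
rewrite patchE indicE fh//.
have E : (w \in [set w | phi_n R n <= Phi X w]) = (w \in [set w | t0 <= tanPhi X w]).
  by apply/idP/idP; rewrite !inE/= phi_n_le_tan.
by rewrite E; case: ifPn; rewrite ?mulr1 ?mulr0.
Qed.

End truncated_expectation.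

Unset Implicit Arguments.
Set Strict Implicit.
Set Printing Implicit Defensive.

Theorem theorem4p2 (R : realType) (d : measure_display) (T : measurableType d)
    (P : probability T R) (alpha n : nat) (X : 'I_n -> {RV P >-> R})
    (alpha_ge1 : (1 <= alpha)%N) (n_ge2 : (2 <= n)%N)
    (X_indep : mutually_independent X)
    (X_gamma : forall i, is_density P (X i) (gamma_pdf alpha%:R)) :
  (exists w : R -> R, is_density P (tanPhi X) w) /\
  forall r : R, 0 < r ->
  let prob := P [set o | Num.sqrt (n%:R - 1) * sample_sd X o <= r] in
  let a := (alpha * n)%N in
  let x := r * Num.sqrt n%:R in
  let c := x ^+ a / Gamma a%:R in
  let u1 : R^nat := fun k =>
    (-1) ^+ k * (gamma_bar X alpha k / (a + k)%:R) * (Ppoly a k).[x] in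
  let u2 : R^nat := fun k =>
    M_bar X alpha k / (a + k)%:R * ((- x) ^+ k / k`!%:R) in
  let u3 (lambda : R) : R^nat := fun k =>
    Delta_bar X alpha k lambda * 'C(a + k - 1, k)%:R *
    gamma_cdf (a + k)%:R (lambda * r) in
  let b := r * Num.sqrt (n%:R * (n%:R - 1)) in
  let tail :=
    W X (1 / Num.sqrt (n%:R - 1)) * gamma_cdf a%:R b +
    \int[lebesgue_measure]_(y in `[b, +oo[) (gamma_pdf a%:R y * W X (x / y)) in
  [/\ (* formula (1) *)
      cvgn (series u1) /\
      (forall w : R -> R, is_density P (tanPhi X) w ->
        prob = (c * limn (series u1) +
          \int[lebesgue_measure]_(t in `[0, 1 / Num.sqrt (n%:R - 1)])
            (gamma_cdf a%:R (x / t) * w t))%:E),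
      (* formula (2) *)
      cvgn (series u2) /\ prob = (c * limn (series u2) + tail)%:E &
      (* formula (3) *)
      forall lambda : R, 0 < lambda ->
        [/\ cvgn (series (u3 lambda)),
            c * limn (series u2) = limn (series (u3 lambda)) &
            prob = (limn (series (u3 lambda)) + tail)%:E]].

Proof.
have alpha_gt0 : (0 < alpha)%N by [].
have [m am] : exists m, (alpha * n)%N = m.+1.
  by exists (alpha * n).-1; rewrite prednK// muln_gt0 alpha_gt0 (leq_trans _ n_ge2).
have [Yd ind ac] := sum_tan_law alpha_gt0 n_ge2 X_indep X_gamma.
have mtan := measurable_tanPhi X n_ge2.
have good := ae_positive alpha_gt0 X_gamma.
have mX i : measurable_fun setT (X i) by exact: measurable_funP.
have n0 : 0 < n%:R :> R by rewrite ltr0n (leq_trans _ n_ge2).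
have n1 : 0 < n%:R - 1 :> R by rewrite subr_gt0 ltr1n.
pose t0 : R := 1 / Num.sqrt (n%:R - 1).
have t00 : 0 < t0 by rewrite divr_gt0// sqrtr_gt0.
split; first exact: density_exists.
move: Yd ind; set Y := fun w => \sum_(i < n) X i w ; rewrite am => Yd ind.
have mY : measurable_fun setT Y by apply: measurable_sum.
have tan_ge0 : {ae P, forall w, 0 <= tanPhi X w}.
  by apply: filterS good => w; exact: tanPhi_ge0.
have gammaE k : gamma_bar X alpha k =
    \int[P]_(w in [set w | t0 <= tanPhi X w]) cos_of_tan (tanPhi X w) ^+ (m.+1 + k).
  rewrite /gamma_bar am.
  apply: (@Ebar_tan _ _ _ _ _ _ _ n_ge2 alpha_gt0 X_gamma _ (fun t => cos_of_tan t ^+ (m.+1 + k))).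
  - under eq_fun do rewrite cos_Phi//; apply: measurable_funX; exact: measurable_cosPhi.
  - by apply: measurable_funX; exact: measurable_cos_of_tan.
  - by move=> w w0; rewrite cos_Phi// cosPhi_tan.
have ME k : M_bar X alpha k =
    \int[P]_(w in [set w | t0 <= tanPhi X w]) (tanPhi X w)^-1 ^+ (m.+1 + k).
  rewrite /M_bar am.
  apply: (@Ebar_tan _ _ _ _ _ _ _ n_ge2 alpha_gt0 X_gamma _ (fun t => t^-1 ^+ (m.+1 + k))).
  - under eq_fun do rewrite cot_Phi//; apply: measurable_funX.
    exact: (measurableT_comp measurable_inv).
  - by apply: measurable_funX; exact: measurable_inv.
  - by move=> w w0; rewrite cot_Phi.
have MsE k lambda : M_bar_scaled X alpha k lambda =
    \int[P]_(w in [set w | t0 <= tanPhi X w])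
      (lambda^-1 * Num.sqrt n%:R * (tanPhi X w)^-1) ^+ (m.+1 + k).
  rewrite /M_bar_scaled am.
  apply: (@Ebar_tan _ _ _ _ _ _ _ n_ge2 alpha_gt0 X_gamma _
    (fun t => (lambda^-1 * Num.sqrt n%:R * t^-1) ^+ (m.+1 + k))).
  - under eq_fun do rewrite cot_Phi//; apply: measurable_funX; apply: measurable_funM => //.
    exact: (measurableT_comp measurable_inv).
  - by apply: measurable_funX; apply: measurable_funM => //; exact: measurable_inv.
  - by move=> w w0; rewrite cot_Phi.
move=> r r0 prob a x c u1 u2 u3 b tail.
have x0 : 0 < x by rewrite mulr_gt0// sqrtr_gt0.
(* The contribution of T >= t0 to the probability: the series of the first two
   formulas sum to A / c, those of the third one to A. *)
pose A := \int[P]_(w in [set w | t0 <= tanPhi X w]) gamma_cdf m.+1%:R (x / tanPhi X w).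
have c0 : c != 0.
  by rewrite /c Gamma_nat mulf_neq0 ?invr_eq0 ?fact_neq0// expf_neq0// gt_eqF.
have cE : c = x ^+ m.+1 / Gamma m.+1%:R by [].
have cvg1 : series u1 @ \oo --> c^-1 * A.
  rewrite cE (_ : u1 = fun k => (-1) ^+ k *
    (\int[P]_(w in [set w | t0 <= tanPhi X w]) cos_of_tan (tanPhi X w) ^+ (m.+1 + k) /
      (m.+1 + k)%:R) * (Ppoly m.+1 k).[x]); first exact: cvg_series_cos.
  by apply/funext => k; rewrite /u1 gammaE.
have cvg2 : series u2 @ \oo --> c^-1 * A.
  rewrite cE (_ : u2 = fun k =>
    \int[P]_(w in [set w | t0 <= tanPhi X w]) (tanPhi X w)^-1 ^+ (m.+1 + k) /
      (m.+1 + k)%:R * ((- x) ^+ k / k`!%:R)); first exact: cvg_series_cot.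
  by apply/funext => k; rewrite /u2 ME.
have cvg3 lambda : 0 < lambda -> series (u3 lambda) @ \oo --> A.
  move=> l0; have k0 : 0 < lambda^-1 * Num.sqrt n%:R by rewrite mulr_gt0 ?invr_gt0 ?sqrtr_gt0.
  have := @cvg_series_difference d T R P (tanPhi X) t0 m mtan t00 _ _ k0 (mulr_gt0 l0 r0).
  rewrite (_ : _ * (lambda * r) = x); last first.
    by rewrite /x; field; rewrite gt_eqF.
  move=> H; rewrite (_ : u3 lambda = fun k => (\sum_(l < k.+1) (-1) ^+ l * 'C(k, l)%:R *
      \int[P]_(w in [set w | t0 <= tanPhi X w])
        (lambda^-1 * Num.sqrt n%:R * (tanPhi X w)^-1) ^+ (m.+1 + l)) *
    'C(m.+1 + k - 1, k)%:R * gamma_cdf (m.+1 + k)%:R (lambda * r)); first exact: H.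
  apply/funext => k; rewrite /u3 /Delta_bar; congr (_ * _ * _).
  by apply: eq_bigr => l _; rewrite MsE.
have lim1 : c * limn (series u1) = A by rewrite (cvg_lim _ cvg1)// mulVKf.
have lim2 : c * limn (series u2) = A by rewrite (cvg_lim _ cvg2)// mulVKf.
have lim3 lambda : 0 < lambda -> limn (series (u3 lambda)) = A.
  by move=> l0; rewrite (cvg_lim _ (cvg3 _ l0)).
have mYt : measurable_fun setT (fun w => Y w * tanPhi X w) by exact: measurable_funM.
have probE : prob = P [set w | Y w * tanPhi X w <= x].
  apply: eq_measure_ae.
  - have msd : measurable_fun setT (fun w => Num.sqrt (n%:R - 1) * sample_sd X w).
      apply: measurable_funM => //; apply: (@measurableT_comp _ _ _ _ _ _ (@Num.sqrt R)).
        by apply: continuous_measurable_fun => ?; exact: sqrt_continuous.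
      apply: measurable_funM => //; apply: measurable_sum => i; apply: measurable_funX.
      by apply: measurable_funB => //; apply: measurable_funM.
    rewrite (_ : [set _ | _] = (fun w => Num.sqrt (n%:R - 1) * sample_sd X w) @^-1` `]-oo, r]).
      by rewrite -[X in measurable X]setTI; exact: msd.
    by apply/seteqP; split => w /=; rewrite in_itv.
  - rewrite (_ : [set _ | _] = (fun w => Y w * tanPhi X w) @^-1` `]-oo, x]).
      by rewrite -[X in measurable X]setTI; exact: mYt.
    by apply/seteqP; split => w /=; rewrite in_itv.
  apply: filterS good => w w0 /=.
  by rewrite (sample_sd_tan n_ge2 w0) ler_pdivrMr ?sqrtr_gt0.
have probA := prob_split mY mtan t00 Yd ind ac tan_ge0 x.
have probA1 w := @prob_near_angle _ _ _ _ _ _ _ t0 mY mtan Yd ind x w.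
have probA2 := prob_near_sum mY mtan t00 Yd ind ac tan_ge0 x0.
have tailE : prob = (A + tail)%:E.
  rewrite probE probA probA2 -EFinD /tail.
  rewrite (_ : b = x / t0)// /b /x /t0 sqrtrM ?ler0n// div1r invrK.
  by rewrite mulrA.
split.
- split; first exact: cvgP cvg1.
  by move=> w wd; rewrite lim1 probE probA (probA1 w).
- by split; [exact: cvgP cvg2 | rewrite lim2].
- move=> lambda l0; split; first exact: cvgP (cvg3 _ l0).
    by rewrite lim2 lim3.
  by rewrite lim3.
Qed.
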